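(* Let $D$ be a digraph. (1) For every infinite family $(R_i)_{i\in I}$ of pairwise disjoint, pairwise equivalent out-rays in $D$ there exists a subgraph $D'$ of $D$ that is a subdivision of either a bidirected quarter-grid or a cyclic quarter-grid, such that each vertical out-ray of $D'$ is an element of $(R_i)_{i\in I}$. (2) For every infinite family $(R_i)_{i\in I}$ of pairwise disjoint, pairwise equivalent in-rays in $D$ there exists a subgraph $D'$ of $D$ that is a subdivision of either a reversed bidirected quarter-grid or a reversed cyclic quarter-grid, such that each vertical in-ray of $D'$ is an element of $(R_i)_{i\in I}$.
   Context: $\mathbb N=\{1,2,\dots\}$, $[n]=\{1,\dots,n\}$. Paths in digraphs are finite and directed. For vertex sets or subgraphs $A,B$, an $A$–$B$ path is a path that starts in $A$, ends in $B$ and has no inner vertex in $A\cup B$. An out-ray (in-ray) is a digraph whose underlying undirected graph is a ray (one-way infinite path) and whose edges are all oriented away from (towards) its unique vertex of degree $1$, its root. Two out- or in-rays $R,R'$ of a digraph $D$ are equivalent if $D$ contains infinitely many pairwise disjoint $R$–$R'$ paths and infinitely many pairwise disjoint $R'$–$R$ paths. Quarter-grids. Let $(R_i)_{i\in\mathbb N}$ be pairwise disjoint out-rays. For a vertex set $X$ let $\lceil X\rceil$ be the union of $X$ and the set of all vertices $v$ lying on some $R_i$ such that the subray of $R_i$ with root $v$ contains a vertex of $X$; for a subgraph $G$ put $\lceil G\rceil:=\lceil V(G)\rceil$. For a sequence $i_1,\dots,i_n$ of indices ($n\ge 2$), a simple $i_1,\dots,i_n$-staircase is a path that is the concatenation of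 $P_1,Q_2,P_2,Q_3,\dots,Q_{n-1},P_{n-1}$, each consisting of exactly one edge, where $P_j$ is an edge from $R_{i_j}$ to $R_{i_{j+1}}$ and $Q_j$ is an edge of $R_{i_j}$ from the end vertex of $P_{j-1}$ to the start vertex of $P_j$. A digraph $D'=\bigcup_{i\in\mathbb N}R_i\cup\bigcup_{n\ge2}G_n$ is considered, where the digraphs $G_n$ (the girders) satisfy: $G_n$ avoids $\lceil G_i\rceil$ for all $2\le i<n$; $D'$ has no vertex whose in-degree and out-degree are both one; the first vertex of each $R_i$ lies in no $G_n$. - $D'$ is a bidirected quarter-grid if, for every $n\ge2$, $G_n$ is the concatenation of a simple $1,2,\dots,n$-staircase $S_n'$, an edge of $R_n$ and a simple $n,n-1,\dots,1$-staircase $S_n''$ such that $S_n''$ avoids $\lceil S_n'\rceil$. - $D'$ is an ascending cyclic quarter-grid if, for every $n\ge 2$, $G_n$ is the concatenation of a simple $1,2,\dots,n$-staircase $S_n$, an edge of $R_n$ and an edge $A_n$ from $R_n$ to $R_1$ such that $A_n$ avoids $\lceil S_n\rceil$. - $D'$ is a descending cyclic quarter-grid if, for every $n\ge2$, $G_n$ is the concatenation of an edge $A_n$ from $R_1$ to $R_n$, an edge of $R_n$ and a simple $n,n-1,\dots,1$-staircase $S_n$ such that $S_n$ avoids $\lceil A_n\rceil$. A cyclic quarter-grid is an ascending or a descending cyclic quarter-grid. The $R_i$ are the vertical out-rays of $D'$. The reversed bidirected and reversed cyclic quarter-grids are obtained by reversing all edges; their vertical in-rays are the reversals of the $R_i$.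 In a subdivision, edges are replaced by internally disjoint directed paths of the same orientation, and the vertical rays of the subdivision are the rays arising from the vertical rays. *)

(* Defs.v *)
From mathcomp Require Import all_boot.
From mathcomp Require Import boolp classical_sets functions cardinality.

Set Implicit Arguments.
Unset Strict Implicit.
Unset Printing Implicit Defensive.

Local Open Scope classical_set_scope.

#[local] Obligation Tactic := idtac.

(* Digraphs have no parallel edges, so edges are ordered pairs of vertices.
   The vertex set is a subset of an ambient type, so that the subgraphs of a
   digraph over V are again digraphs over V. *)
Record digraph (V : Type) := Digraph {
  verts : set V;
  edge : V -> V -> Prop;
  edge_verts : forall u v, edge u v -> verts u /\ verts v }.

Definition subgraph (V : Type) (A B : digraph V) : Prop :=
  verts A `<=` verts B /\ forall u v, edge A u v -> edge B u v.

Program Definition reverse (V : Type) (A : digraph V) : digraph V :=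
  {| verts := verts A; edge := fun u v => edge A v u |}.
Next Obligation. by move=> V A u v /(@edge_verts _ A)[]. Qed.

Program Definition edgeless (V : Type) (X : set V) : digraph V :=
  {| verts := X; edge := fun _ _ => False |}.
Next Obligation. by []. Qed.

Program Definition dunion (V : Type) (A B : digraph V) : digraph V :=
  {| verts := verts A `|` verts B;
     edge := fun u v => edge A u v \/ edge B u v |}.
Next Obligation.
move=> V A B u v.
by case=> [/(@edge_verts _ A)|/(@edge_verts _ B)] [? ?]; split; by [left | right].
Qed.

Program Definition bigunion (V I : Type) (J : set I) (F : I -> digraph V) :
    digraph V :=
  {| verts := \bigcup_(i in J) verts (F i);
     edge := fun u v => exists2 i, J i & edge (F i) u v |}.
Next Obligation.
by move=> V I J F u v [i Ji /(@edge_verts _ (F i))[? ?]]; split; exists i.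
Qed.

Program Definition arc (V : Type) (a b : V) : digraph V :=
  {| verts := [set a; b]; edge := fun u v => u = a /\ v = b |}.
Next Obligation. by move=> V a b u v [-> ->]; split; [left | right]. Qed.

(* The path p 0, p 1, ..., p n. *)
Program Definition path_of (V : Type) (n : nat) (p : nat -> V) : digraph V :=
  {| verts := p @` `I_n.+1;
     edge := fun u v => exists2 k, (k < n)%N & u = p k /\ v = p k.+1 |}.
Next Obligation.
move=> V n p u v [k kn [-> ->]].
by split; [exists k => //=; apply: ltnW | exists k.+1].
Qed.

Definition dipath (V : Type) (P : digraph V) (u v : V) : Prop :=
  exists n (p : nat -> V),
    [/\ {in `I_n.+1 &, injective p}, P = path_of n p, p 0 = u & p n = v].

Program Definition out_ray_of (V : Type) (r : nat -> V) : digraph V :=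
  {| verts := range r;
     edge := fun u v => exists k, u = r k /\ v = r k.+1 |}.
Next Obligation.
by move=> V r u v [k [-> ->]]; split; [exists k | exists k.+1].
Qed.

Program Definition in_ray_of (V : Type) (r : nat -> V) : digraph V :=
  {| verts := range r;
     edge := fun u v => exists k, u = r k.+1 /\ v = r k |}.
Next Obligation.
by move=> V r u v [k [-> ->]]; split; [exists k.+1 | exists k].
Qed.

Definition out_ray_from (V : Type) (R : digraph V) (v : V) : Prop :=
  exists r : nat -> V, [/\ injective r, R = out_ray_of r & r 0 = v].

Definition out_ray (V : Type) (R : digraph V) : Prop :=
  exists v, out_ray_from R v.

Definition in_ray (V : Type) (R : digraph V) : Prop :=
  exists r : nat -> V, injective r /\ R = in_ray_of r.

Definition AB_path (V : Type) (D : digraph V) (A B : set V) (P : digraph V) :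
    Prop :=
  subgraph P D /\
  exists u v, [/\ dipath P u v, A u, B v &
    (verts P `\` [set u; v]) `&` (A `|` B) = set0].

Definition infinitely_many_disjoint_paths (V : Type) (D : digraph V)
    (A B : set V) : Prop :=
  exists PP : set (digraph V),
    [/\ infinite_set PP, PP `<=` AB_path D A B & trivIset PP (@verts V)].

Definition equivalent_rays (V : Type) (D R R' : digraph V) : Prop :=
  infinitely_many_disjoint_paths D (verts R) (verts R') /\
  infinitely_many_disjoint_paths D (verts R') (verts R).

(* Families indexed by the positive integers are functions on nat whose value
   at 0 is ignored; likewise girders are only considered for n >= 2. *)

Definition down_closure (W : Type) (R : nat -> digraph W) (X : set W) : set W :=
  X `|` [set v | exists i, [/\ (0 < i)%N, verts (R i) v &
    exists Q, [/\ out_ray_from Q v, subgraph Q (R i) &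
                  verts Q `&` X !=set0]]].

Definition avoids (W : Type) (A : digraph W) (X : set W) : Prop :=
  verts A `&` X = set0.

(* S is a simple (ix 1), ..., (ix n)-staircase with first vertex u and last
   vertex v; P_j is the edge (a j, b j) and Q_j the edge (b j.-1, a j). *)
Definition simple_staircase (W : Type) (R : nat -> digraph W) (n : nat)
    (ix : nat -> nat) (S : digraph W) (u v : W) : Prop :=
  dipath S u v /\
  exists a b : nat -> W,
    [/\ forall j, (1 <= j < n)%N ->
          verts (R (ix j)) (a j) /\ verts (R (ix j.+1)) (b j),
        forall j, (2 <= j < n)%N -> edge (R (ix j)) (b j.-1) (a j),
        u = a 1, v = b n.-1 &
        S = dunion (bigunion [set j | (1 <= j < n)%N] (fun j => arc (a j) (b j)))
              (bigunion [set j | (2 <= j < n)%N] (fun j => arc (b j.-1) (a j)))].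

Definition ascending_staircase (W : Type) (R : nat -> digraph W) (n : nat) :=
  simple_staircase R n (fun j => j).

Definition descending_staircase (W : Type) (R : nat -> digraph W) (n : nat) :=
  simple_staircase R n (fun j => n.+1 - j).

Definition bidirected_girder (W : Type) (R : nat -> digraph W) (n : nat)
    (G : digraph W) : Prop :=
  exists S' S'' u v u' v',
    [/\ ascending_staircase R n S' u v, edge (R n) v u',
        descending_staircase R n S'' u' v',
        avoids S'' (down_closure R (verts S')) &
        G = dunion (dunion S' (arc v u')) S''].

Definition ascending_girder (W : Type) (R : nat -> digraph W) (n : nat)
    (G : digraph W) : Prop :=
  exists S u v a b,
    [/\ ascending_staircase R n S u v, edge (R n) v a,
        verts (R n) a /\ verts (R 1) b,
        avoids (arc a b) (down_closure R (verts S)) &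
        G = dunion (dunion S (arc v a)) (arc a b)].

Definition descending_girder (W : Type) (R : nat -> digraph W) (n : nat)
    (G : digraph W) : Prop :=
  exists a b S u v,
    [/\ verts (R 1) a /\ verts (R n) b, edge (R n) b u,
        descending_staircase R n S u v,
        avoids S (down_closure R (verts (arc a b))) &
        G = dunion (dunion (arc a b) (arc b u)) S].

Definition in_degree_one (W : Type) (H : digraph W) (v : W) : Prop :=
  exists! u, edge H u v.

Definition out_degree_one (W : Type) (H : digraph W) (v : W) : Prop :=
  exists! w, edge H v w.

Record rays_with_girders (W : Type) (H : digraph W) (R G : nat -> digraph W) :
    Prop := {
  rwg_rays : forall i, (0 < i)%N -> out_ray (R i);
  rwg_disjoint : trivIset [set i | (0 < i)%N] (fun i => verts (R i));
  rwg_union : H = dunion (bigunion [set i | (0 < i)%N] R)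
                         (bigunion [set n | (1 < n)%N] G);
  rwg_avoid : forall i n, (2 <= i < n)%N ->
    avoids (G n) (down_closure R (verts (G i)));
  rwg_degree : forall v, verts H v -> ~ (in_degree_one H v /\ out_degree_one H v);
  rwg_root : forall i v n, (0 < i)%N -> (1 < n)%N ->
    out_ray_from (R i) v -> ~ verts (G n) v }.

(* In the following, R is the family of vertical rays. *)

Definition bidirected_quarter_grid (W : Type) (H : digraph W)
    (R : nat -> digraph W) : Prop :=
  exists G, rays_with_girders H R G /\
    forall n, (2 <= n)%N -> bidirected_girder R n (G n).

Definition ascending_cyclic_quarter_grid (W : Type) (H : digraph W)
    (R : nat -> digraph W) : Prop :=
  exists G, rays_with_girders H R G /\
    forall n, (2 <= n)%N -> ascending_girder R n (G n).

Definition descending_cyclic_quarter_grid (W : Type) (H : digraph W)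
    (R : nat -> digraph W) : Prop :=
  exists G, rays_with_girders H R G /\
    forall n, (2 <= n)%N -> descending_girder R n (G n).

Definition cyclic_quarter_grid (W : Type) (H : digraph W)
    (R : nat -> digraph W) : Prop :=
  ascending_cyclic_quarter_grid H R \/ descending_cyclic_quarter_grid H R.

Definition reversed_bidirected_quarter_grid (W : Type) (H : digraph W)
    (R : nat -> digraph W) : Prop :=
  exists H0 R0, [/\ bidirected_quarter_grid H0 R0,
    H = reverse H0 & R = (fun i => reverse (R0 i))].

Definition reversed_cyclic_quarter_grid (W : Type) (H : digraph W)
    (R : nat -> digraph W) : Prop :=
  exists H0 R0, [/\ cyclic_quarter_grid H0 R0,
    H = reverse H0 & R = (fun i => reverse (R0 i))].

Definition edge_set (W : Type) (H : digraph W) : set (W * W) :=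
  [set e | edge H e.1 e.2].

Definition inner_verts (W V : Type) (phi : W -> V) (P : W * W -> digraph V)
    (e : W * W) : set V :=
  verts (P e) `\` [set phi e.1; phi e.2].

(* D' is the subdivision of the loopless digraph H with branch vertices phi x,
   where each edge e of H is replaced by the path P e. *)
Definition subdivision (W V : Type) (H : digraph W) (D' : digraph V)
    (phi : W -> V) (P : W * W -> digraph V) : Prop :=
  [/\ {in verts H &, injective phi},
      forall e, edge_set H e -> dipath (P e) (phi e.1) (phi e.2),
      forall e, edge_set H e ->
        inner_verts phi P e `&` (phi @` verts H) = set0,
      trivIset (edge_set H) (inner_verts phi P) &
      D' = dunion (edgeless (phi @` verts H)) (bigunion (edge_set H) P)].

(* The subgraph of the subdivision arising from the subgraph A (without
   isolated vertices) of the subdivided digraph. *)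
Definition subdivided (W V : Type) (P : W * W -> digraph V) (A : digraph W) :
    digraph V :=
  bigunion (edge_set A) P.

(* Main.v *)
Require Import Defs.
From mathcomp Require Import all_boot.
From mathcomp Require Import boolp classical_sets functions cardinality filter.
From mathcomp Require Import zify.
(* [all_boot] shadows [Defs.arc] by [path.arc]. *)
Import Defs.

Set Implicit Arguments.
Unset Strict Implicit.
Unset Printing Implicit Defensive.

Local Open Scope classical_set_scope.

(* Write [A a b F] if there are infinitely many disjoint paths from ray [a] to
   ray [b] that avoid the rays in the finite set [F].  Fix a ray [0].  For each
   [n] the rays [0, ..., n] carry an in-tree with root [0] whose edges [a -> b]
   avoid all other rays up to [n]; suppressing a ray keeps it such an in-tree,
   so a limit along an ultrafilter gives a tree order on all rays.  By Ramsey's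
   theorem there is a subsequence that is an antichain (a star: every ray
   reaches [0] directly), an increasing chain, or a decreasing chain.  Doing
   this for in-trees and for out-trees leaves nine cases, each of which yields a
   sequence of rays along which one can go up and down (bidirected), or go up
   (down) and return directly to the start (cyclic).  The girders are then built
   greedily jump by jump; every new jump meets only finitely many rays, which
   are discarded from those not yet in use. *)

(** * Extracting a chain of rays *)

(** The obstacle is that equivalence of two rays says nothing about the other rays: all paths
    between them may be forced to cross a third one. The only avoidance that comes for free is
    [link_cut]: between two disjoint finite sets of rays, some pair is linked off all the other rays
    of both sets. This is pigeonhole over the finitely many pairs. It controls rays up to [n] only,
    and the trees for different [n] need not cohere, which is why a limit is taken. Avoiding
    finitely many rays is enough because girder [n] only has to respect the [n] rays in use.
    Discarding rays is harmless because the properties of the chains pass to subsequences. Ray 0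
    must survive every selection, since the cyclic types return to it. In-trees alone offer no way
    out of the root; out-trees are in-trees for reversed links, and both are obtained on a common
    subsequence. In the grids, a branch vertex is named by its ray and by the number of earlier
    visits to that ray, so the order along a ray is the order of time. All avoidance conditions on
    girders reduce to this. In-rays are treated by reversing [D]. *)

Lemma dependent_choice_inv (T : Type) (Inv : nat -> T -> Prop)
    (Step : nat -> T -> T -> Prop) (x0 : T) :
  Inv 0 x0 ->
  (forall n x, Inv n x -> exists y, Inv n.+1 y /\ Step n x y) ->
  exists f : nat -> T, [/\ f 0 = x0, forall n, Inv n (f n) &
    forall n, Step n (f n) (f n.+1)].
Proof.
move=> I0 IS.
have /choice [g gP] : forall nx : nat * T, exists y, Inv nx.1 nx.2 ->
    Inv nx.1.+1 y /\ Step nx.1 nx.2 y.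
  move=> [n x] /=; have [/IS[y yP]|nI] := pselect (Inv n x); first by exists y.
  by exists x => /nI.
pose f := fix f n := if n is m.+1 then g (m, f m) else x0.
have If n : Inv n (f n) by elim: n => //= n /(gP (n, _))[].
by exists f; split => // n; have [] := gP (n, f n) (If n).
Qed.

Lemma finite_set_nat_bound (F : set nat) :
  finite_set F -> exists M, forall f, F f -> (f < M)%N.
Proof.
move=> /finite_seqP[s ->]; exists (\max_(i <- s) i).+1 => f fs.
by rewrite ltnS; exact: leq_bigmax_seq.
Qed.

Lemma bounded_finite_set (F : set nat) M :
  (forall f, F f -> (f < M)%N) -> finite_set F.
Proof. by move=> FM; apply: (sub_finite_set _ (finite_II M)) => f /FM. Qed.

Lemma strict_mono (s : nat -> nat) :
  (forall n, (s n < s n.+1)%N) -> forall m n, (m < n)%N -> (s m < s n)%N.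
Proof.
move=> sS m n; elim: n => // n IH; rewrite ltnS leq_eqVlt => /orP[/eqP->//|/IH].
by move=> /ltn_trans; apply.
Qed.

Lemma strict_mono_inj (s : nat -> nat) :
  (forall m n, (m < n)%N -> (s m < s n)%N) -> injective s.
Proof.
move=> sM m n; case: (ltngtP m n) => // /sM; first by move=> + e; rewrite e ltnn.
by move=> + e; rewrite e ltnn.
Qed.

(* [A a b F] abstracts "there are infinitely many disjoint paths from ray [a]
   to ray [b] that avoid the rays in [F]". *)
Record linkage (A : nat -> nat -> set nat -> Prop) : Prop := Linkage {
  link_anti : forall a b F G, F `<=` G -> A a b G -> A a b F;
  link_trans : forall a b c F, A a b F -> A b c F -> A a c F;
  link_cut : forall S T, finite_set S -> finite_set T -> S `&` T = set0 ->
    S !=set0 -> T !=set0 ->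
    exists a b, [/\ S a, T b & A a b ((S `|` T) `\` [set a; b])] }.

(** An in-tree for [flip A] is an out-tree for [A], so the one-sided analysis is done only once. *)
Definition flip (A : nat -> nat -> set nat -> Prop) a b F := A b a F.

(** Passage to the subfamily selected by [x]: only selected rays have to be avoided. *)
Definition pull (x : nat -> nat) (A : nat -> nat -> set nat -> Prop) a b F :=
  A (x a) (x b) (x @` F).

Lemma linkage_flip A : linkage A -> linkage (flip A).
Proof.
case=> an tr cu; split=> [a b F G /an|a b c F ba cb|S T fS fT ST S0 T0].
- exact.
- exact: tr cb ba.
- have [|//|//|a [b [Ta Sb Aab]]] := cu T S fT fS; first by rewrite setIC.
  by exists b, a; split=> //; rewrite /flip setUC (setUC [set b]).
Qed.

Lemma linkage_pull A x : injective x -> linkage A -> linkage (pull x A).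
Proof.
move=> xI [an tr cu]; split=> [a b F G FG|a b c F|S T fS fT ST S0 T0].
- by apply: an; exact: image_subset.
- exact: tr.
- have [|||_ [_ [[a Sa <-] [b Tb <-] Aab]]] :=
    cu (x @` S) (x @` T) (finite_image _ fS) (finite_image _ fT).
  + rewrite -subset0 => _ [[s Ss <-] [t Tt /xI ts]].
    by suff : (S `&` T) s; [rewrite ST|split=> //; rewrite -ts].
  + exact: image_nonempty.
  + exact: image_nonempty.
  exists a, b; split=> //; apply: an Aab => _ [c [STc cab] <-]; split.
    by rewrite -image_setU; exists c.
  by apply: contra_not cab => -[] /xI ->; [left|right].
Qed.

(* [r a b] reads "[a] lies on the path from [b] to the root [0]" of an in-tree
   on [S]; the vertices of [`I_n.+1] off the segment from [b] to [a] are avoided. *)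
Definition in_tree_order (A : nat -> nat -> set nat -> Prop) (n : nat)
    (S : set nat) (r : nat -> nat -> Prop) : Prop :=
  [/\ forall a, S a -> r 0 a /\ r a a,
      forall a b, r a b -> r b a -> a = b,
      forall a b, r a b -> S a /\ S b &
      forall a b F, r a b -> a <> b -> F `<=` `I_n.+1 ->
        (forall f, F f -> (r f a /\ f <> a) \/ ~ r f b) -> A b a F].

(** As in Prim's algorithm: the cut between the rays outside the tree and those in it provides an
    edge from some [v] outside to some [u] inside that avoids all other rays up to [n]. Then [v] is
    attached as a leaf to [u], its ancestors being itself and those of [u]. *)
Lemma in_tree_order_extend A n S r : linkage A -> in_tree_order A n S r ->
  S `<=` `I_n.+1 -> S 0 -> (exists2 v, `I_n.+1 v & ~ S v) ->
  exists v r', [/\ `I_n.+1 v, ~ S v & in_tree_order A n (v |` S) r'].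
Proof.
move=> [an tr cu] [rS ras rsub rA] SI S0 [w Iw Sw].
have [|||||v [u [[Iv Sv] Su Avu]]] := cu (`I_n.+1 `\` S) S.
- by apply: finite_setD; exact: finite_II.
- by apply: (sub_finite_set SI); exact: finite_II.
- by rewrite setDKI.
- by exists w.
- by exists 0.
have {}Avu : A v u (`I_n.+1 `\` [set v; u]).
  apply: an Avu => f [If fvu]; split=> //.
  by have [|] := pselect (S f); [right|left].
exists v, (fun a b => r a b \/ (b = v /\ (a = v \/ r a u))); split=> //.
have nr a : ~ r a v by move=> /rsub[].
have nl a : ~ r v a by move=> /rsub[].
split.
- move=> a [->|/rS[r0 ra]]; last by split; left.
  by split; right; split=> //; [right; case: (rS _ Su)|left].
- move=> a b [rab|[eb [ea|rau]]] [rba|[ea' _]]; first exact: ras.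
  + by move: rab; rewrite ea' => /nl.
  + by rewrite eb.
  + by rewrite eb.
  + by move: rba; rewrite eb => /nl.
  + by move: rau; rewrite ea' => /nl.
- move=> a b [/rsub[Sa Sb]|[-> [->|/rsub[Sa _]]]]; split; by [left|right].
- move=> a b F [rab|[-> [->//|rau]]] ab FI Fr.
    apply: (rA _ _ _ rab ab FI) => f /Fr[[[rfa|[e _]] fa]|nfb].
    + by left.
    + by move: rab; rewrite e => /nl.
    + by right=> rfb; apply: nfb; left.
  have av : a <> v by move=> e; rewrite e in rau; exact: nl rau.
  (* [F] omits both ends of the new edge, since [v] and [u] lie on the tree path from [v] to [a];
     hence the new edge avoids all of [F]. *)
  have Fv : ~ F v.
    by move=> /Fr[[[/nl//|[/av//]]]|]; apply; right; split=> //; left.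
  have Fu : ~ F u.
    move=> /Fr[[[rua|[/av//]] ua]|].
      by apply: ua; exact: ras.
    by apply; right; split=> //; right; case: (rS _ Su).
  have AvuF : A v u F.
    by apply: an Avu => f Ff; split; [exact: FI|case=> e; rewrite e in Ff].
  have [->//|au] := eqVneq a u.
  apply: (tr _ _ _ _ AvuF); apply: (rA _ _ _ rau (elimN eqP au) FI) => f Ff.
  have [[[rfa|[/av//]] fa]|nfv] := Fr _ Ff; first by left.
  by right=> rfu; apply: nfv; right; split=> //; right.
Qed.

Lemma in_tree_order_exists A n : linkage A ->
  exists r, in_tree_order A n `I_n.+1 r.
Proof.
move=> LA.
suff H k : (k <= n)%N -> exists s : seq nat, [/\ uniq s, size s = k.+1, 0 \in s,
    {subset s <= iota 0 n.+1} & exists r, in_tree_order A n [set` s] r].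
  have [s [us ss _ sI [r rP]]] := H n (leqnn n).
  exists r; suff <- : [set` s] = `I_n.+1 by [].
  have [|_ e] := uniq_min_size us sI; first by rewrite size_iota ss.
  by apply/seteqP; split=> a /=; rewrite e mem_iota.
elim: k => [_|k IH kn].
  exists [:: 0]; split=> //.
    by move=> a; rewrite inE mem_iota => /eqP->.
  exists (fun a b => a = 0 /\ b = 0); split.
  - by move=> a /=; rewrite inE => /eqP.
  - by move=> a b [-> ->].
  - by move=> a b [-> ->].
  - by move=> a b F [-> ->].
have [s [us ss s0 sI [r rP]]] := IH (ltnW kn).
have sI' : [set` s] `<=` `I_n.+1 by move=> a /= /sI; rewrite mem_iota.
have [||v [r' [Iv sv r'P]]] := in_tree_order_extend LA rP sI'; first by [].
  apply: contrapT => nv; suff : {subset iota 0 n.+1 <= s}.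
    by move=> /(uniq_leq_size (iota_uniq _ _)); rewrite size_iota ss; lia.
  move=> v; rewrite mem_iota => /andP[_ vn]; apply: contrapT => sv.
  by apply: nv; exists v.
exists (v :: s); split.
- by rewrite cons_uniq us andbT; apply/negP.
- by rewrite /= ss.
- by rewrite inE s0 orbT.
- by move=> a; rewrite inE => /orP[/eqP->|/sI//]; rewrite mem_iota; exact: Iv.
- exists r'; suff -> : [set` v :: s] = v |` [set` s] by [].
  apply/seteqP; split=> a /=; rewrite inE; first by move=> /orP[/eqP|]; [left|right].
  by case=> [->|/= ->]; rewrite ?eqxx ?orbT.
Qed.

(** * Limits of trees and the three types of chains *)

Lemma nonprincipal_ultrafilter_nat :
  exists U : set_system nat, UltraFilter U /\ forall n, U [set m | (n <= m)%N].
Proof.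
have [U [UU sU]] := @ultraFilterLemma nat eventually _.
by exists U; split=> // n; apply: sU; exists n.
Qed.

Lemma filter_bounded_forall (U : set_system nat) (F : set nat)
    (P : nat -> nat -> Prop) :
  Filter U -> finite_set F -> (forall f, F f -> U (P f)) ->
  U [set n | forall f, F f -> P f n].
Proof.
move=> FU /finite_set_nat_bound[M FM] UP.
suff H k : U [set n | forall f, (f < k)%N -> F f -> P f n].
  by apply: filterS (H M) => n nP f Ff; apply: nP (FM _ Ff) Ff.
elim: k => [|k IH]; first by apply: filterE.
have [Fk|nFk] := pselect (F k).
  apply: filterS2 IH (UP _ Fk) => n H1 H2 f.
  by rewrite ltnS leq_eqVlt => /orP[/eqP->//|]; exact: H1.
apply: filterS IH => n H1 f; rewrite ltnS leq_eqVlt => /orP[/eqP->//|].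
exact: H1.
Qed.

(** The ultrafilter proof of Ramsey's theorem. A state is the last point chosen together with a
    [U]-large reservoir all of whose members are larger and in relation [C] to that point.
    Reservoirs only shrink, so all later points keep these relations. *)
Lemma ramsey_pairs (U : set_system nat) (C : nat -> nat -> Prop) (B : set nat) :
  UltraFilter U -> (forall n, U [set m | (n <= m)%N]) -> U B ->
  (forall a, B a -> U (C a)) ->
  exists x : nat -> nat, [/\ forall n, (x n < x n.+1)%N, forall n, (0 < x n)%N &
    forall m n, (m < n)%N -> C (x m) (x n)].
Proof.
move=> UU Uge UB UC.
pose Inv (n : nat) (s : nat * set nat) :=
  [/\ (0 < s.1)%N, U s.2, s.2 `<=` B & forall b, s.2 b -> C s.1 b /\ (s.1 < b)%N].
pose Step (n : nat) (s s' : nat * set nat) := s.2 s'.1 /\ s'.2 `<=` s.2.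
have new (X : set nat) : U X -> X `<=` B ->
    exists s, Inv 0 s /\ (X s.1 /\ s.2 `<=` X).
  move=> UX XB.
  have [a [Xa a0]] := filter_ex (filterI UX (Uge 1)).
  exists (a, X `&` (C a `&` [set b | (a < b)%N])); split; last first.
    by split=> //= b [].
  split=> //=.
  - by apply: filterI => //; apply: filterI; [exact: UC (XB _ Xa)|exact: (Uge a.+1)].
  - by move=> b [/XB].
  - by move=> b [_ []].
have [s0 [Is0 _]] := new B UB (fun _ => id).
have [|f [_ fI fS]] := @dependent_choice_inv _ Inv Step s0 Is0.
  by move=> n s [_ Us sB _]; have [y yP] := new _ Us sB; exists y.
have sub m n : (m <= n)%N -> (f n).2 `<=` (f m).2.
  elim: n => [|n IH]; first by rewrite leqn0 => /eqP->.
  rewrite leq_eqVlt => /orP[/eqP->//|/IH mn].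
  by apply: subset_trans mn; case: (fS n).
have H m n : (m < n)%N -> (f m).2 (f n).1.
  by case: n => // n mn; apply: (sub m n) => //; case: (fS n).
exists (fun n => (f n).1); split=> [n|n|m n /H].
- by have [_ _ _ /(_ _ (H n n.+1 (ltnSn n)))[]] := fI n.
- by case: (fI n).
- by have [_ _ _ h] := fI m; move=> /h[].
Qed.

Definition in_star (A : nat -> nat -> set nat -> Prop) : Prop :=
  forall a F, finite_set F -> (0 < a)%N -> ~ F a -> ~ F 0 -> A a 0 F.

(** Here smaller indices are nearer the root. The tree path from [b] to [a] may use the rays with
    index between them, so exactly these cannot be required to be avoided. *)
Definition in_descent (A : nat -> nat -> set nat -> Prop) : Prop :=
  forall a b F, finite_set F -> (a < b)%N ->
    (forall f, F f -> (f < a)%N \/ (b < f)%N) -> A b a F.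

(** Here larger positive indices are nearer the root 0. The tree path from [b] to 0 runs through
    indices above [b], so the second clause promises only to avoid the smaller positive ones. *)
Definition in_ascent (A : nat -> nat -> set nat -> Prop) : Prop :=
  (forall a b F, finite_set F -> (0 < a < b)%N ->
    (forall f, F f -> (f < a)%N \/ (b < f)%N) -> A a b F) /\
  (forall b F, (0 < b)%N -> (forall f, F f -> (0 < f < b)%N) -> A b 0 F).

Lemma one_sided A : linkage A ->
  exists x : nat -> nat, [/\ forall m n, (m < n)%N -> (x m < x n)%N, x 0 = 0 &
    [\/ in_star (pull x A), in_descent (pull x A) | in_ascent (pull x A)]].
Proof.
move=> LA; have [U [UU Uge]] := nonprincipal_ultrafilter_nat.
have /choice[R RP] := fun n => in_tree_order_exists n LA.
(* The limit order: [a] lies on the path from [b] to the root in [U]-almost every tree. *)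
pose L a b := U [set n | R n a b].
have LN a b : ~ L a b -> U [set n | ~ R n a b].
  by move=> nL; have [//|] := in_ultra_setVsetC [set n | R n a b] UU.
have L0 a : L 0 a.
  apply: filterS (Uge a) => n /= an.
  by have [/(_ a an)[]] := RP n.
have Lasym a b : L a b -> a <> b -> ~ L b a.
  move=> Lab ab Lba; have [n [n1 n2]] := filter_ex (filterI Lab Lba).
  by apply: ab; have [_ + _ _] := RP n; apply.
(* Finitely many facts about [L] hold together in a single tree [R n] with [n] beyond [F], and the
   link is read off from that tree. *)
have LA' a b F : finite_set F -> L a b -> a <> b ->
    (forall f, F f -> (L f a /\ f <> a) \/ ~ L f b) -> A b a F.
  move=> fF Lab ab FL.
  have [M FM] := finite_set_nat_bound fF.
  have UF : U [set n | forall f, F f -> (R n f a /\ f <> a) \/ ~ R n f b].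
    apply: filter_bounded_forall => // f /FL[[Lfa fa]|/LN].
      by apply: filterS Lfa => n; left.
    by apply: filterS => n; right.
  have [n [n1 [n2 n3]]] := filter_ex (filterI UF (filterI Lab (Uge M))).
  have [_ _ _ nA] := RP n; apply: nA n2 ab _ n1 => f /FM /= fM.
  by apply: leq_trans fM _; apply: leq_trans n3 _.
(* Three colours: incomparable, [a] nearer the root, [b] nearer the root. Each [a] has a colour
   shared by [U]-almost all [b], and one colour is the typical one for [U]-almost all [a]. *)
pose c0 a b := ~ L a b /\ ~ L b a; pose c1 a b := L a b; pose c2 a b := L b a.
pose B (c : nat -> nat -> Prop) := [set a | U (c a)].
have Bcase : [\/ U (B c0), U (B c1) | U (B c2)].
  have [|U0] := in_ultra_setVsetC (B c0) UU; first by constructor 1.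
  have [|U1] := in_ultra_setVsetC (B c1) UU; first by constructor 2.
  constructor 3; apply: filterS2 U0 U1 => a b0 b1; apply: contrapT => b2.
  have [//|{}b1] := in_ultra_setVsetC (c1 a) UU.
  have [//|{}b2] := in_ultra_setVsetC (c2 a) UU.
  by apply: b0; apply: filterS2 b1 b2 => b n1 n2.
(* Ramsey's theorem is applied to positive indices only; the root 0, comparable to everything, is
   put back in front. *)
pose ext (x : nat -> nat) n := if n is m.+1 then x m else 0.
have extP (x : nat -> nat) : (forall n, (x n < x n.+1)%N) ->
    (forall n, (0 < x n)%N) -> forall m n, (m < n)%N -> (ext x m < ext x n)%N.
  by move=> xS x0; apply: strict_mono => -[|n] /=.
have setup c : U (B c) -> exists x : nat -> nat,
    [/\ forall m n, (m < n)%N -> (x m < x n)%N, x 0 = 0 &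
        forall m n, (0 < m < n)%N -> c (x m) (x n)].
  move=> Uc; have [x [xS x0 xC]] := @ramsey_pairs U c (B c) UU Uge Uc (fun _ => id).
  exists (ext x); split=> //; first exact: extP.
  by move=> [|m] [|n] //=; rewrite ltnS; exact: xC.
case: Bcase => /setup [x [xM x0 xC]]; exists x; split=> //.
- constructor 1 => a F fF a0 Fa F0; rewrite /pull x0.
  have xI := strict_mono_inj xM.
  apply: LA'; [exact: finite_image|exact: L0| |].
    by have := xM _ _ a0; rewrite x0; lia.
  move=> _ [f Ff <-]; right.
  have f0 : (0 < f)%N by case: f Ff.
  case: (ltngtP f a) => [fa|af|e]; last by rewrite e in Ff.
    by have [|] := xC f a; first lia.
  by have [|] := xC a f; first lia.
- have Lx m n : (m < n)%N -> L (x m) (x n).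
    by case: m => [|m] mn; [rewrite x0|exact: xC].
  constructor 2 => a b F fF ab Fab.
  have xab := xM _ _ ab.
  apply: LA'; [exact: finite_image|exact: Lx|lia|].
  move=> _ [f /Fab[fa|bf] <-]; [left|right].
    by split; [exact: Lx|have := xM _ _ fa; lia].
  by apply: Lasym; [exact: Lx|have := xM _ _ bf; lia].
- constructor 3; split=> [a b F fF /andP[a0 ab] Fab|b F b0 Fb].
    have xab := xM _ _ ab.
    apply: LA'; [exact: finite_image|by apply: xC; rewrite a0|lia|].
    move=> _ [f /Fab[fa|bf] <-]; last first.
      left; split; last by have := xM _ _ bf; lia.
      by apply: xC; lia.
    have [->|f0] := posnP f.
      left; split; first by rewrite x0.
      by have := xM 0 b; lia.
    right; apply: Lasym; last by have := xM _ _ fa; lia.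
    by apply: xC; lia.
  rewrite /pull x0; apply: LA'.
  + by apply: finite_image; apply: (@bounded_finite_set _ b) => f /Fb; lia.
  + exact: L0.
  + by have := xM _ _ b0; lia.
  move=> _ [f /Fb fb <-]; right; apply: Lasym; first by apply: xC.
  have : (f < b)%N by lia.
  by move=> /xM; lia.
Qed.

Definition bidirected_chain (A : nat -> nat -> set nat -> Prop) : Prop :=
  forall a b F, finite_set F -> (a < b)%N ->
    (forall f, F f -> (f < a)%N \/ (b < f)%N) -> A a b F /\ A b a F.

(** The return link may meet rays beyond [b]. This does no harm: a girder returns from the last ray
    in use, and later rays can still be discarded. For [flip A] this is the descending version. *)
Definition cyclic_chain (A : nat -> nat -> set nat -> Prop) : Prop :=
  (forall a b F, finite_set F -> (a < b)%N ->
    (forall f, F f -> (f < a)%N \/ (b < f)%N) -> A a b F) /\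
  (forall b F, (0 < b)%N -> (forall f, F f -> (0 < f < b)%N) -> A b 0 F).

Section pull.
Variables (A : nat -> nat -> set nat -> Prop) (s : nat -> nat).
Hypotheses (sM : forall m n, (m < n)%N -> (s m < s n)%N).

Let outside a b F : (forall f, F f -> (f < a)%N \/ (b < f)%N) ->
  forall f, (s @` F) f -> (f < s a)%N \/ (s b < f)%N.
Proof. by move=> Fab _ [f /Fab[/sM|/sM] h <-]; [left|right]. Qed.

Let inside b F : s 0 = 0 -> (forall f, F f -> (0 < f < b)%N) ->
  forall f, (s @` F) f -> (0 < f < s b)%N.
Proof.
move=> s0 Fb _ [f /Fb/andP[f0 fb] <-].
by rewrite (sM fb) andbT -[X in (X < _)%N]s0 sM.
Qed.

Lemma bidirected_chain_pull : bidirected_chain A -> bidirected_chain (pull s A).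
Proof.
by move=> H a b F fF ab /outside; apply: H; [exact: finite_image|exact: sM].
Qed.

Hypothesis s0 : s 0 = 0.

Let sgt0 a : (0 < a)%N -> (0 < s a)%N.
Proof. by move=> /sM; rewrite s0. Qed.

Lemma in_star_pull : in_star A -> in_star (pull s A).
Proof.
have sI := strict_mono_inj sM.
move=> H a F fF a0 Fa F0; rewrite /pull s0; apply: H.
- exact: finite_image.
- exact: sgt0.
- by move=> [f Ff /sI e]; rewrite e in Ff.
- by move=> [f Ff]; rewrite -{1}s0 => /sI e; rewrite e in Ff.
Qed.

Lemma in_descent_pull : in_descent A -> in_descent (pull s A).
Proof.
by move=> H a b F fF ab /outside; apply: H; [exact: finite_image|exact: sM].
Qed.

Lemma in_ascent_pull : in_ascent A -> in_ascent (pull s A).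
Proof.
case=> H1 H2; split=> [a b F fF /andP[a0 ab] /outside|b F b0 /(inside s0)].
  by apply: H1; [exact: finite_image|rewrite sgt0 ?sM].
by rewrite /pull s0; apply: H2; exact: sgt0.
Qed.

(** The return link ends at ray 0, which is why a selection has to fix 0. *)
Lemma cyclic_chain_pull : cyclic_chain A -> cyclic_chain (pull s A).
Proof.
case=> H1 H2; split=> [a b F fF ab /outside|b F b0 /(inside s0)].
  by apply: H1; [exact: finite_image|exact: sM].
by rewrite /pull s0; apply: H2; exact: sgt0.
Qed.

End pull.

Lemma star_ascent_cyclic A : in_star A -> in_descent (flip A) -> cyclic_chain A.
Proof.
move=> st de; split=> [a b F|b F b0 Fb]; first exact: de.
apply: st => // [|/Fb|/Fb]; [|lia|lia].
by apply: (@bounded_finite_set _ b) => f /Fb; lia.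
Qed.

Lemma ascent_star_cyclic A : in_ascent A -> in_star (flip A) -> cyclic_chain A.
Proof.
move=> [as1 as2] st; split=> // a b F fF ab Fab.
(* [in_ascent] has no upward links out of ray 0; the out-star supplies them. *)
have [a0|a0] := posnP a; last by apply: as1; rewrite ?a0.
subst a; apply: st => // /Fab; lia.
Qed.

Lemma ascent_ascent_cyclic A :
  in_ascent A -> in_descent (flip A) -> cyclic_chain A.
Proof. by move=> [_ as2] de; split=> // a b F; exact: de. Qed.

Lemma chain_exists A : linkage A ->
  exists x : nat -> nat, (forall m n, (m < n)%N -> (x m < x n)%N) /\
    [\/ bidirected_chain (pull x A), cyclic_chain (pull x A) |
        cyclic_chain (flip (pull x A))].
Proof.
move=> LA; have [x [xM x0 xA]] := one_sided LA.
have LB : linkage (pull x A) by apply: linkage_pull => //; exact: strict_mono_inj.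
have [y [yM y0 yA]] := one_sided (linkage_flip LB).
set B := pull x A in xA LB yA *.
have LC : linkage (pull y B) by apply: linkage_pull => //; exact: strict_mono_inj.
have {}xA : [\/ in_star (pull y B), in_descent (pull y B) | in_ascent (pull y B)].
  case: xA => H; [constructor 1|constructor 2|constructor 3].
  - exact: in_star_pull.
  - exact: in_descent_pull.
  - exact: in_ascent_pull.
have pullE z : pull (x \o (y \o z)) A = pull z (pull y B).
  by apply/funext => a; apply/funext => b; apply/funext => F;
    rewrite /B /pull /= !image_comp.
have {}yA : [\/ in_star (flip (pull y B)), in_descent (flip (pull y B)) |
  in_ascent (flip (pull y B))] by [].
set C := pull y B in xA yA LC pullE *.
have simple : [\/ bidirected_chain C, cyclic_chain C | cyclic_chain (flip C)] ->
  exists x : nat -> nat, (forall m n, (m < n)%N -> (x m < x n)%N) /\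
    [\/ bidirected_chain (pull x A), cyclic_chain (pull x A) |
        cyclic_chain (flip (pull x A))].
  have -> : C = pull (x \o (y \o id)) A.
    rewrite pullE; apply/funext => a; apply/funext => b; apply/funext => F.
    by rewrite /pull image_id.
  by move=> H; exists (x \o (y \o id)); split=> //= m n /yM /xM.
(* When both trees are stars, every link between two leaves is routed through ray 0; when both are
   ascents, the links given for chains do not involve 0. In these two cases ray 0 is dropped. *)
have shifted : bidirected_chain (pull succn C) ->
  exists x : nat -> nat, (forall m n, (m < n)%N -> (x m < x n)%N) /\
    [\/ bidirected_chain (pull x A), cyclic_chain (pull x A) |
        cyclic_chain (flip (pull x A))].
  rewrite -pullE => H; exists (x \o (y \o succn)).
  split; last by constructor 1.
  by move=> m n mn /=; apply/xM/yM.
have succF F : finite_set F -> finite_set (succn @` F) by exact: finite_image.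
(* The in-tree type varies slowest, the out-tree type fastest, each in the order star, descent,
   ascent. *)
case: xA yA => cin [] cout.
- apply: shifted => a b F fF ab Fab; rewrite /pull.
  have F0 : ~ [set f.+1 | f in F] 0 by case.
  have Fa : ~ [set f.+1 | f in F] a.+1 by case=> f /Fab + [e]; lia.
  have Fb : ~ [set f.+1 | f in F] b.+1 by case=> f /Fab + [e]; lia.
  have {}succF := succF _ fF.
  by split; apply: (link_trans LC (b := 0));
    [exact: cin|exact: cout|exact: cin|exact: cout].
- by apply: simple; constructor 2; exact: star_ascent_cyclic.
- by apply: simple; constructor 3; exact: ascent_star_cyclic.
- by apply: simple; constructor 3; apply: star_ascent_cyclic.
- by apply: simple; constructor 1 => a b F fF ab Fab; split;
    [exact: cout|exact: cin].
- by apply: simple; constructor 3; exact: ascent_ascent_cyclic.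
- by apply: simple; constructor 2; exact: ascent_star_cyclic.
- by apply: simple; constructor 2; exact: ascent_ascent_cyclic.
- case: cin cout => [c1 _] [d1 _]; apply: shifted => a b F fF ab Fab.
  have Fab' f : [set f.+1 | f in F] f -> (f < a.+1)%N \/ (b.+1 < f)%N.
    by move=> [g /Fab + <-]; lia.
  by split; [apply: c1|apply: d1] => //; exact: succF.
Qed.

(** * Links between rays *)

Definition walk (V : Type) (D : digraph V) (S : set V) (n : nat)
    (p : nat -> V) : Prop :=
  (forall k, (k <= n)%N -> S (p k)) /\
  (forall k, (k < n)%N -> edge D (p k) (p k.+1)).

(** Walks rather than paths, so that links concatenate freely; injectivity is recovered by
    [shortest_walk]. *)
Definition reach (V : Type) (D : digraph V) (S : set V) (u v : V) : Prop :=
  exists n p, [/\ walk D S n p, p 0 = u & p n = v].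

Section walks.
Variables (V : Type) (D : digraph V).

Lemma reach_trans S u v w : reach D S u v -> reach D S v w -> reach D S u w.
Proof.
move=> [m [p [[pS pE] p0 pm]]] [n [q [[qS qE] q0 qn]]].
exists (m + n)%N, (fun k => if (k <= m)%N then p k else q (k - m)%N); split.
- split=> k kn.
    by case: leqP => km; [exact: pS|apply: qS; lia].
  case: (ltngtP k m) => km.
  + exact: pE.
  + by rewrite subSn ?(ltnW km) //; apply: qE; lia.
  + by rewrite km pm -q0 subSn // subnn; apply: qE; lia.
- by [].
- case: leqP => h; last by rewrite addKn.
  have n0 : n = 0 by lia.
  by rewrite -qn n0 addn0 pm.
Qed.

Lemma reach_sub S T u v : S `<=` T -> reach D S u v -> reach D T u v.
Proof.
move=> ST [n [p [[pS pE] p0 pn]]].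
by exists n, p; split=> //; split=> // k /pS /ST.
Qed.

(** The length is minimised over all ends in [X] and [Y], not just [u] and [v]. A repeated vertex,
    or an inner vertex in [X] or [Y], would then allow a shorter walk. *)
Lemma shortest_walk S (X Y : set V) u v : X `&` Y = set0 -> X u -> Y v ->
  reach D S u v ->
  exists n p, [/\ walk D S n p, X (p 0) /\ Y (p n), (0 < n)%N,
    {in `I_n.+1 &, injective p} &
    forall k, (0 < k < n)%N -> ~ X (p k) /\ ~ Y (p k)].
Proof.
move=> XY Xu Yv uv.
pose Q n := exists p, [/\ walk D S n p, X (p 0) & Y (p n)].
have [|n /asboolP[p [[pS pE] p0 pn]] nmin] := @ex_minnP (fun n => `[< Q n >]).
  have [n [p [pw p0 pn]]] := uv; exists n; apply/asboolP.
  by exists p; split=> //; rewrite ?p0 ?pn.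
have {}nmin m : (m < n)%N -> ~ Q m.
  by move=> mn Qm; have := nmin m; rewrite leqNgt mn /= => /(_ (asboolT Qm)).
have loop i j : (i < j)%N -> (j <= n)%N -> p i <> p j.
  move=> ij jn e; apply: (nmin (n - (j - i))); first lia.
  exists (fun l => if (l <= i)%N then p l else p (l + (j - i))%N); split.
  - split=> k kn.
      by case: leqP => ki; apply: pS; lia.
    case: (ltngtP k i) => ki.
    + by apply: pE; lia.
    + by rewrite addSn; apply: pE; lia.
    + by rewrite ki e (_ : (i.+1 + (j - i))%N = j.+1); [apply: pE|]; lia.
  - by [].
  - case: leqP => h; last by rewrite subnK //; lia.
    have -> : (n - (j - i))%N = i by lia.
    by rewrite e; have -> : j = n by lia.
exists n, p; split=> //.
- case: n pn {pS pE nmin loop} => // pn.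
  by suff : (X `&` Y) (p 0); [rewrite XY|].
- move=> i j; rewrite !inE /= => ijn jn e; case: (ltngtP i j) => // h.
    by have := loop _ _ h jn e.
  by have := loop _ _ h ijn; rewrite e.
move=> k /andP[k0 kn]; split=> Xk; [apply: (nmin (n - k)); first lia|apply: (nmin _ kn)].
- exists (fun i => p (k + i)%N); split; rewrite ?addn0 ?subnKC ?(ltnW kn) //.
  split=> i h; first by apply: pS; lia.
  by rewrite addnS; apply: pE; lia.
- by exists p; split=> //; split=> i h; [apply: pS|apply: pE]; lia.
Qed.

End walks.

Definition rays (V : Type) (r : nat -> nat -> V) (F : set nat) : set V :=
  [set v | exists2 f, F f & exists k, v = r f k].

(** Avoiding every finite set replaces infinitely many disjoint paths: for distinct disjoint rays
    the two are equivalent by greedy choice, but this form is easier to compose. *)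
Definition ray_link (V : Type) (D : digraph V) (r : nat -> nat -> V)
    (a b : nat) (F : set nat) : Prop :=
  forall Z, finite_set Z ->
    exists i j, reach D (~` (Z `|` rays r F)) (r a i) (r b j).

Definition disjoint_rays (V : Type) (r : nat -> nat -> V) : Prop :=
  forall a i b j, r a i = r b j -> a = b /\ i = j.

Lemma finite_set_index_bound (V T : Type) (Z : set V) (s : T -> V) (g : T -> nat) :
  (forall t t', s t = s t' -> g t = g t') -> finite_set Z ->
  exists M, forall t, (M <= g t)%N -> ~ Z (s t).
Proof.
move=> sg fZ.
have /choice [k kP] : forall z, exists n, forall t, s t = z -> g t = n.
  move=> z; have [[t tz]|nt] := pselect (exists t, s t = z).
    by exists (g t) => t'; rewrite -tz => /sg.
  by exists 0 => t tz; case: nt; exists t.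
have [M MP] := finite_set_nat_bound (finite_image k fZ).
exists M => t Mt Zt; have : (k @` Z) (k (s t)) by exists (s t).
by move=> /MP; rewrite -(kP _ t) // ltnNge Mt.
Qed.

Section rays.
Variables (V : Type) (D : digraph V) (r : nat -> nat -> V).
Hypotheses (rI : disjoint_rays r) (rE : forall a i, edge D (r a i) (r a i.+1)).

Lemma ray_eventually_avoids Z a : finite_set Z ->
  exists M, forall k, (M <= k)%N -> ~ Z (r a k).
Proof. by apply: finite_set_index_bound (id) _ => i j /rI[]. Qed.

Lemma eventually_ray_avoids Z : finite_set Z ->
  exists M, forall a k, (M <= a)%N -> ~ Z (r a k).
Proof.
move=> fZ.
have [|M MP] := @finite_set_index_bound _ (nat * nat)%type Z
  (fun t => r t.1 t.2) (fun t => t.1) _ fZ; first by move=> t t' /rI[].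
by exists M => a k; exact: (MP (a, k)).
Qed.

Lemma reach_ray S a i j : (i <= j)%N ->
  (forall k, (i <= k <= j)%N -> S (r a k)) -> reach D S (r a i) (r a j).
Proof.
move=> ij aS; exists (j - i)%N, (fun k => r a (i + k)); split.
- split=> k kn; first by apply: aS; lia.
  by rewrite addnS.
- by rewrite addn0.
- by rewrite subnKC.
Qed.

Lemma ray_link_linkage :
  (forall a b Z, a <> b -> finite_set Z ->
     exists i j, reach D (~` Z) (r a i) (r b j)) ->
  linkage (ray_link D r).
Proof.
move=> lk; split.
- move=> a b F G FG H Z /H[i [j ij]]; exists i, j; apply: reach_sub ij.
  by apply: subsetC; apply: setUS => v [f /FG Gf fv]; exists f.
(* The first walk is made to end on ray [b] at some [j >= N], beyond which [b] misses [Z]; the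
   second is made to start at some [j' > j]. The segment of [b] in between joins them, and it avoids
   [F] because the end of the first walk shows that [b] is not in [F]. *)
- move=> a b c F ab bc Z fZ.
  have [N NP] := ray_eventually_avoids b fZ.
  have [|i [j ij]] := ab (Z `|` r b @` `I_N).
    by rewrite finite_setU; split=> //; exact/finite_image/finite_II.
  have [|j' [k jk]] := bc (Z `|` r b @` `I_j.+1).
    by rewrite finite_setU; split=> //; exact/finite_image/finite_II.
  have subZ (X Y W : set V) : ~` ((X `|` Y) `|` W) `<=` ~` (X `|` W).
    by apply: subsetC => v [|]; [left; left|right].
  exists i, k; apply: reach_trans (reach_sub (@subZ _ _ _) ij) _.
  apply: reach_trans (reach_sub (@subZ _ _ _) jk).
  have [n [p [[pS _] _ pn]]] := ij; have := pS n (leqnn n).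
  rewrite pn => /not_orP[/not_orP[_ jN] bF].
  have [m [q [[qS _] q0 _]]] := jk; have := qS 0 (leq0n m).
  rewrite q0 => /not_orP[/not_orP[_ jj'] _].
  have Nj : (N <= j)%N by rewrite leqNgt; apply/negP => jN'; apply: jN; exists j.
  have {}jj' : (j < j')%N.
    by rewrite ltnNge; apply/negP => h; apply: jj'; exists j'.
  apply: reach_ray => [|l jl]; first exact: ltnW.
  move=> [|[f Ff [l0 /rI[bf _]]]]; first by apply: NP; lia.
  by apply: bF; exists b; [rewrite bf|exists j].
(* Otherwise every pair has a finite blocking set [Z], and the union of these is finite. A walk from
   [S] to [T] avoiding the union, shortened to have no inner vertex on these rays, joins some pair
   and meets no other ray of [S] or [T], against the choice of the blocking set of that pair. *)
- move=> S T fS fT ST [a0 Sa0] [b0 Tb0]; apply: contrapT => no.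
  have {}ST f : S f -> T f -> False.
    by move=> Sf Tf; suff : (S `&` T) f; [rewrite ST|split].
  have /choice [Z ZP] : forall ab : nat * nat, exists Z, finite_set Z /\
      (S ab.1 -> T ab.2 -> forall i j, ~ reach D
        (~` (Z `|` rays r ((S `|` T) `\` [set ab.1; ab.2]))) (r ab.1 i) (r ab.2 j)).
    move=> [a b] /=.
    have [Sa|nSa] := pselect (S a); last by exists set0.
    have [Tb|nTb] := pselect (T b); last by exists set0.
    apply: contrapT => nZ; apply: no; exists a, b; split=> // Z fZ.
    apply: contrapT => nij; apply: nZ; exists Z; split=> // _ _ i j ij.
    by apply: nij; exists i, j.
  have abne : a0 <> b0 by move=> e; apply: (ST a0) => //; rewrite e.
  pose ZZ := \bigcup_(ab in S `*` T) Z ab.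
  have fZZ : finite_set ZZ.
    by apply: bigcup_finite; [exact: finite_setX|move=> ab _; case: (ZP ab)].
  have [i0 [j0 ij0]] := lk _ _ _ abne fZZ.
  have XY : rays r S `&` rays r T = set0.
    rewrite -subset0 => v [[f Sf [k ->]] [g Tg [l /rI[fg _]]]].
    by apply: (ST f) => //; rewrite fg.
  have [||n [p [[pS pE] [[a Sa [i pi]] [b Tb [j pj]]] n0 _ pin]]] :=
    shortest_walk XY _ _ ij0.
  + by exists a0 => //; exists i0.
  + by exists b0 => //; exists j0.
  have [_ /= /(_ Sa Tb i j)] := ZP (a, b); apply.
  exists n, p; split=> //; split=> // k kn.
  apply/not_orP; split.
    by move=> Zk; apply: (pS _ kn); exists (a, b).
  move=> [f [STf fab] [l pk]].
  have [k0|k0] := posnP k.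
    by apply: fab; left; move: pk; rewrite k0 pi => /rI[].
  move: kn; rewrite leq_eqVlt => /orP[/eqP kn|kn].
    by apply: fab; right; move: pk; rewrite kn pj => /rI[].
  have [|nX nY] := pin k; first lia.
  by case: STf => h; [apply: nX|apply: nY]; exists f => //; exists l.
Qed.

End rays.

(** Otherwise choosing a point of [Z] in each member embeds the infinite family into [Z]. *)
Lemma disjoint_family_avoids (V T : Type) (PP : set T) (X : T -> set V) (Z : set V) :
  infinite_set PP -> trivIset PP X -> finite_set Z ->
  exists2 P, PP P & forall v, X P v -> ~ Z v.
Proof.
move=> iP tP fZ; apply: contrapT => no.
have /choice [z zP] : forall P, exists v, PP P -> X P v /\ Z v.
  move=> P; have [Q PQ] := infinite_setN0 iP.
  apply: contrapT => nv; apply: no.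
  have [PP'|nP] := pselect (PP P); last first.
    by exists Q => // v _ _; apply: nv; exists v => /nP.
  by exists P => // v Xv Zv; apply: nv; exists v.
have zI : {in PP &, injective z}.
  move=> P Q; rewrite !inE => PPP PPQ zz; apply: tP => //; exists (z P).
  by have [XP _] := zP _ PPP; have [XQ _] := zP _ PPQ; split=> //; rewrite zz.
apply: iP; have /eq_finite_set <- := inj_card_eq zI.
by apply: sub_finite_set fZ => _ [P /zP[_ ZP] <-].
Qed.

Lemma disjoint_paths_avoid (V : Type) (D : digraph V) (A B Z : set V) :
  infinitely_many_disjoint_paths D A B -> finite_set Z ->
  exists u v, [/\ A u, B v & reach D (~` Z) u v].
Proof.
move=> [PP [iP PPAB tP]] fZ.
have [P /PPAB[[_ PD] [u [v [[n [p [_ eP p0 pn]]] Au Bv _]]]] PZ] :=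
  disjoint_family_avoids iP tP fZ.
exists u, v; split=> //; exists n, p; split=> //; split=> k kn.
- by apply: PZ; rewrite eP; exists k.
- by apply: PD; rewrite eP; exists k.
Qed.

(** * Disjoint jumps *)

(* The [t]-th jump is the path [p t 0, ..., p t (ell t)] from ray [h t.*2] to
   ray [h t.*2.+1]; [pos u] is the position at which the [u]-th jump endpoint
   (in the order start, end, start, end, ...) lies on its ray. *)
Record jump_system (V : Type) (D : digraph V) (r : nat -> nat -> V)
    (h ell : nat -> nat) (p : nat -> nat -> V) (pos : nat -> nat) : Prop := {
  js_rays : disjoint_rays r;
  js_ray_edge : forall k i, edge D (r k i) (r k i.+1);
  js_edge : forall t i, (i < ell t)%N -> edge D (p t i) (p t i.+1);
  js_inj : forall t i t' i', (i <= ell t)%N -> (i' <= ell t')%N ->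
    p t i = p t' i' -> t = t' /\ i = i';
  js_start : forall t, p t 0 = r (h t.*2) (pos t.*2);
  js_end : forall t, p t (ell t) = r (h t.*2.+1) (pos t.*2.+1);
  js_inner : forall t i k j, (0 < i < ell t)%N -> p t i <> r k j;
  js_pos_gt0 : forall u, (0 < pos u)%N;
  js_pos : forall u u', (u < u')%N -> h u = h u' -> (pos u < pos u')%N }.

(** [sel] is the current selection of rays. The finite set [used] collects the earlier jumps and the
    initial segments of rays up to their endpoints; blocking whole segments forces later endpoints
    to lie further out. The other fields describe the latest jump, so state [t.+1] holds jump
    [t]. *)
Record jump_state (V : Type) := JumpState {
  sel : nat -> nat;
  used : set V;
  jlen : nat;
  jpath : nat -> V;
  jstart : nat;
  jend : nat }.

Definition jump_inv (V : Type) (t : nat) (s : jump_state V) : Prop :=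
  [/\ finite_set (used s), forall m n, (m < n)%N -> (sel s m < sel s n)%N &
      sel s 0 = 0].

(** [N t] is the number of rays in use at time [t]: these are frozen, and all others are replaced by
    rays that miss everything used so far. *)
Record jump_step (V : Type) (D : digraph V) (r : nat -> nat -> V)
    (h N : nat -> nat) (t : nat) (s s' : jump_state V) : Prop := {
  step_sel : forall k, (k < N t)%N -> sel s' k = sel s k;
  step_fresh : forall k i, (N t <= k)%N -> ~ used s' (r (sel s' k) i);
  step_used : used s `<=` used s';
  step_walk : walk D (~` used s) (jlen s') (jpath s');
  step_inj : {in `I_(jlen s').+1 &, injective (jpath s')};
  step_start : jpath s' 0 = r (sel s (h t.*2)) (jstart s');
  step_end : jpath s' (jlen s') = r (sel s (h t.*2.+1)) (jend s');
  step_inner : forall i k j, (0 < i < jlen s')%N -> (k < N t)%N ->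
    jpath s' i <> r (sel s k) j;
  step_start_gt0 : (0 < jstart s')%N;
  step_end_gt0 : (0 < jend s')%N;
  step_used_path : forall i, (i <= jlen s')%N -> used s' (jpath s' i);
  step_used_start : forall i, (i <= jstart s')%N ->
    used s' (r (sel s (h t.*2)) i);
  step_used_end : forall i, (i <= jend s')%N ->
    used s' (r (sel s (h t.*2.+1)) i) }.

Section jumps.
Variables (V : Type) (D : digraph V) (r : nat -> nat -> V) (h N : nat -> nat).
Hypotheses (rI : disjoint_rays r) (rE : forall k i, edge D (r k i) (r k i.+1)).
Hypothesis (hne : forall t, h t.*2 <> h t.*2.+1).
Hypothesis (hN : forall t, (h t.*2 < N t)%N /\ (h t.*2.+1 < N t)%N).
Hypothesis (Nmono : forall t t', (t <= t')%N -> (N t <= N t')%N).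
Hypothesis (Nunb : forall k, exists t, (k < N t)%N).
Hypothesis lk : forall s : nat -> nat,
  (forall m n, (m < n)%N -> (s m < s n)%N) -> s 0 = 0 ->
  forall t, pull s (ray_link D r) (h t.*2) (h t.*2.+1)
    [set c | (c < N t)%N /\ c <> h t.*2 /\ c <> h t.*2.+1].

(** The link avoids the used vertices and the other rays in use, but may meet later rays. Being
    finite it meets finitely many of them. The hypothesis [lk] covers all selections fixing 0, hence
    also the current [sel s]. *)
Lemma jump_step_exists t s : jump_inv t s ->
  exists s', jump_inv t.+1 s' /\ jump_step D r h N t s s'.
Proof.
move=> [fU sM s0]; have sI := strict_mono_inj sM.
set f := h t.*2; set g := h t.*2.+1.
have fg : f <> g by exact: hne.
(* The two roots are avoided as well, so that jumps start and end at positive positions. *)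
have [|i0 [j0 ij]] := @lk (sel s) sM s0 t (used s `|` [set r (sel s f) 0; r (sel s g) 0]).
  by rewrite finite_setU; split=> //; exact: finite_set2.
have XY : rays r [set sel s f] `&` rays r [set sel s g] = set0.
  rewrite -subset0 => v [[a -> [k ->]] [b -> [l /rI[/sI/fg]]]] //.
have [||n [p [[pS pE] [[a -> [i pi]] [b -> [j pj]]] n0 pI pin]]] :=
  shortest_walk XY _ _ ij; [by exists (sel s f) => //; exists i0|
                            by exists (sel s g) => //; exists j0|].
have i_gt0 : (0 < i)%N.
  case: i pi => // pi; exfalso; apply: (pS 0 (leq0n _)).
  by left; right; left.
have j_gt0 : (0 < j)%N.
  case: j pj => // pj; exfalso; apply: (pS n (leqnn _)).
  by left; right; right.
pose U := used s `|` ((p @` `I_n.+1) `|`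
  ((r (sel s f) @` `I_i.+1) `|` (r (sel s g) @` `I_j.+1))).
have fU' : finite_set U.
  rewrite !finite_setU; do !split=> //; exact/finite_image/finite_II.
have [M MP] := eventually_ray_avoids rI fU'.
(* No ray with index at least [M] meets [U], so adding [M] discards every ray that was hit and keeps
   the selection increasing. *)
pose s' k := if (k < N t)%N then sel s k else (sel s k + M)%N.
exists (JumpState s' U n p i j); split.
  split=> //=.
  - move=> m m' mm'; rewrite /s'; have := sM _ _ mm'.
    by case: (ltnP m (N t)); case: (ltnP m' (N t)); lia.
  - by rewrite /s'; case: (ltnP 0 (N t)) => // N0; have [] := hN t; lia.
split=> //=.
- by move=> k kN; rewrite /s' kN.
- by move=> k l kN; rewrite /s' ltnNge kN /=; apply: MP; lia.
- by move=> v; left.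
- split=> // k kn; apply: contra_not (pS k kn); by left; left.
- move=> l k m ln kN e.
  have [kf|kf] := pselect (k = f).
    have [+ _] := pin l ln; apply; exists (sel s f) => //.
    by exists m; rewrite e kf.
  have [kg|kg] := pselect (k = g).
    have [_] := pin l ln; apply; exists (sel s g) => //.
    by exists m; rewrite e kg.
  have ln' : (l <= n)%N by lia.
  apply: (pS l ln'); right; exists (sel s k); last by exists m.
  by exists k.
- by move=> l ln; right; left; exists l.
- by move=> l li; right; right; left; exists l.
- by move=> l lj; right; right; right; exists l.
Qed.

Lemma jump_system_exists : exists s ell p pos,
  injective s /\ jump_system D (fun k => r (s k)) h ell p pos.
Proof.
have [|S [_ SI SS]] := @dependent_choice_inv _ (@jump_inv V)
  (jump_step D r h N) (JumpState id set0 0 (r 0) 0 0) _ jump_step_exists.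
  by split=> //=; exact: finite_set0.
have UM t t' : (t <= t')%N -> used (S t) `<=` used (S t').
  elim: t' => [|t' IH]; first by rewrite leqn0 => /eqP->.
  rewrite leq_eqVlt => /orP[/eqP->//|/IH tt'].
  by apply: subset_trans tt' _; exact: step_used (SS t').
have selE t t' k : (t <= t')%N -> (k < N t)%N -> sel (S t') k = sel (S t) k.
  elim: t' => [|t' IH]; first by rewrite leqn0 => /eqP->.
  rewrite leq_eqVlt => /orP[/eqP->//|tt'] kN.
  rewrite -(IH tt' kN); apply: (step_sel (SS t')).
  by apply: leq_trans kN _; exact: Nmono.
have [T TP] := choice Nunb.
(* The selection stabilises: its entry [k] is final as soon as [k < N t]. *)
pose s k := sel (S (T k)) k.
have sE t k : (k < N t)%N -> sel (S t) k = s k.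
  move=> kN; rewrite /s; case: (leqP t (T k)) => tT; first by rewrite (selE t (T k)).
  by rewrite (selE (T k) t) // ltnW.
have sI : injective s.
  move=> k l kl; pose m := maxn (T k) (T l).
  have km : (k < N m)%N by apply: leq_trans (TP k) _; apply: Nmono; rewrite leq_maxl.
  have lm : (l < N m)%N by apply: leq_trans (TP l) _; apply: Nmono; rewrite leq_maxr.
  move: kl; rewrite -(sE m) // -(sE m) //.
  by have [_ /strict_mono_inj sM _] := SI m; exact: sM.
have fresh t k i : (N t <= k)%N -> ~ used (S t.+1) (r (s k) i).
  (* [t'] is a last time at which ray [k] is not in use. Its final choice is made in that step and
     misses all vertices used up to then. *)
  move=> tk; suff H d : (N (t + d) <= k)%N \/
      exists2 t', (t <= t')%N & (N t' <= k < N t'.+1)%N.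
    have [|[t' tt' /andP[t'k kt']]] := H (T k).
      by have := TP k; have := @Nmono (T k) (t + T k); rewrite leq_addl; lia.
    rewrite -(sE t'.+1) // => /(UM t.+1 t'.+1 tt').
    exact: (step_fresh (SS t')).
  elim: d => [|d [IH|IH]]; [by left; rewrite addn0| |by right].
  case: (leqP (N (t + d.+1)) k) => h'; first by left.
  by right; exists (t + d)%N; rewrite ?leq_addr // IH -addnS.
pose ell t := jlen (S t.+1); pose p t := jpath (S t.+1).
pose pos u := if odd u then jend (S u./2.+1) else jstart (S u./2.+1).
have posS t : pos t.*2 = jstart (S t.+1) by rewrite /pos odd_double doubleK.
have posE t : pos t.*2.+1 = jend (S t.+1).
  by rewrite /pos /= odd_double /= uphalf_double.
have hsel t : sel (S t) (h t.*2) = s (h t.*2) /\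
    sel (S t) (h t.*2.+1) = s (h t.*2.+1).
  by have [? ?] := hN t; split; exact: sE.
have usedpos u u' i : (u./2 < u'./2)%N -> (i <= pos u)%N ->
    used (S u'./2) (r (s (h u)) i).
  move=> uu' ip; apply: (UM u./2.+1) => //.
  have [h1 h2] := hsel u./2.
  move: ip; rewrite -[u]odd_double_half; case: (odd u) => /=; rewrite ?add1n ?add0n.
  - rewrite posE uphalf_double => ip.
    by rewrite -h2; apply: (step_used_end (SS _)).
  - rewrite posS doubleK => ip.
    by rewrite -h1; apply: (step_used_start (SS _)).
have notused u : ~ used (S u./2) (r (s (h u)) (pos u)).
  have [h1 h2] := hsel u./2; have [wS _] := step_walk (SS u./2).
  rewrite -[u]odd_double_half; case: (odd u) => /=; rewrite ?add1n ?add0n.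
  - rewrite posE uphalf_double -h2 -(step_end (SS _)); exact: wS.
  - rewrite posS doubleK -h1 -(step_start (SS _)); exact: wS.
exists s, ell, p, pos; split=> //; split=> //.
- by move=> a i b j /rI[/sI].
- by move=> t i; have [_] := step_walk (SS t); apply.
- have lt t i t' i' : (t < t')%N -> (i <= ell t)%N -> (i' <= ell t')%N ->
    p t i <> p t' i'.
    move=> tt' il il' e; have [wS _] := step_walk (SS t').
    by apply: (wS i' il'); rewrite -/(p t') -e; apply: (UM t.+1) => //;
      exact: (step_used_path (SS t)).
  move=> t i t' i' il il'; case: (ltngtP t t') => [/lt H|/lt H|tt'] e.
  + by case: (H i i').
  + by case: (H i' i).
  + subst t'; split=> //; apply: (step_inj (SS t)) => //; rewrite inE //.
- by move=> t; rewrite posS -(proj1 (hsel t)) -(step_start (SS t)).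
- by move=> t; rewrite posE -(proj2 (hsel t)) -(step_end (SS t)).
(* Rays in use are avoided by the choice of the jump, later ones by [fresh]. *)
- move=> t i k j il; case: (ltnP k (N t)) => kN.
    by rewrite -(sE t) //; exact: (step_inner (SS t)).
  move=> e; apply: (fresh t k j kN); rewrite -e.
  by apply: (step_used_path (SS t)); rewrite /ell in il; lia.
- by move=> u; rewrite /pos; case: odd;
    [exact: (step_end_gt0 (SS _))|exact: (step_start_gt0 (SS _))].
- move=> u u' uu' hu.
  case: (ltngtP u./2 u'./2) => c; last 2 first.
  + by have := half_leq (ltnW uu'); lia.
  (* Both endpoints belong to the same jump, whose ends lie on different rays. *)
  + exfalso; apply: (hne (t := u./2)).
    suff [<- <-] : u = u./2.*2 /\ u' = u./2.*2.+1 by [].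
    by have := odd_double_half u; have := odd_double_half u'; lia.
  rewrite ltnNge; apply/negP => pp.
  by apply: (notused u'); rewrite -hu; exact: usedpos.
Qed.

End jumps.

(** * Branch vertices and the subdivision *)

Lemma digraph_ext (V : Type) (A B : digraph V) :
  (forall v, verts A v <-> verts B v) ->
  (forall u v, edge A u v <-> edge B u v) -> A = B.
Proof.
case: A B => [vA eA AP] [vB eB BP] /= hv he.
have ev : vA = vB by apply/funext => v; apply/propext.
have ee : eA = eB by apply/funext => u; apply/funext => v; apply/propext.
by subst; congr Digraph; exact: Prop_irrelevance.
Qed.

Definition label_count (h : nat -> nat) (k u : nat) : nat :=
  count (fun u' => h u' == k) (iota 0 u).

(* The [u]-th jump endpoint, as the branch vertex with the given index on the
   vertical ray [h u]; index [0] is the root of the ray. *)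
Definition touch (h : nat -> nat) (u : nat) : nat * nat :=
  (h u, (label_count h (h u) u).+1).

(** The vertical rays, common to all grids built here. The predecessor reconciles the numbering of
    vertical rays from 1 with that of [r] and [h] from 0. *)
Definition column (k : nat) : digraph (nat * nat) :=
  out_ray_of (fun j => (k.-1, j)).

Section touches.
Variable h : nat -> nat.
Hypothesis hinf : forall k n, exists2 u, (n <= u)%N & h u = k.

Lemma label_countS k u :
  label_count h k u.+1 = (label_count h k u + (h u == k))%N.
Proof. by rewrite /label_count -addn1 iotaD count_cat /= addn0. Qed.

Lemma label_count_mono k u u' : (u <= u')%N ->
  (label_count h k u <= label_count h k u')%N.
Proof.
elim: u' => [|u' IH]; first by rewrite leqn0 => /eqP->.
rewrite leq_eqVlt => /orP[/eqP->//|/IH]; rewrite label_countS.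
by move=> /leq_trans; apply; exact: leq_addr.
Qed.

Lemma touch_mono u u' : (u < u')%N -> h u = h u' ->
  ((touch h u).2 < (touch h u').2)%N.
Proof.
move=> uu' hu; rewrite /touch /= ltnS -hu.
by apply: leq_trans (label_count_mono _ uu'); rewrite label_countS eqxx addn1.
Qed.

Lemma touch_inj : injective (touch h).
Proof.
move=> u u' e; have hu : h u = h u' by case: e.
case: (ltngtP u u') => // [/touch_mono/(_ hu)|/touch_mono/(_ (esym hu))];
  by rewrite e ltnn.
Qed.

Lemma label_count_unbounded k j : exists n, (j < label_count h k n)%N.
Proof.
elim: j => [|j [n jn]].
  have [u _ hu] := hinf k 0; exists u.+1.
  by rewrite label_countS hu eqxx addn1.
have [u nu hu] := hinf k n; exists u.+1.
rewrite label_countS hu eqxx addn1.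
by have := label_count_mono k nu; lia.
Qed.

(** The least [n] whose count exceeds [j] comes right after a visit to [k] that has exactly [j]
    predecessors. *)
Lemma touch_surj k j : exists u, touch h u = (k, j.+1).
Proof.
have [[//|u] ju umin] := ex_minnP (label_count_unbounded k j).
have := umin u; rewrite ltnn leqNgt => /contra_notN; move: ju.
rewrite label_countS; case: eqP => [hu|]; last by rewrite addn0; lia.
rewrite addn1 ltnS => h1 h2; exists u; rewrite /touch hu; congr (_, _.+1).
by apply/eqP; rewrite eqn_leq h1 andbT leqNgt; apply/negP => h3;
  move: (umin u h3); rewrite ltnn.
Qed.

Lemma touch_inverse : exists g : nat * nat -> nat,
  cancel (touch h) g /\ forall k j, touch h (g (k, j.+1)) = (k, j.+1).
Proof.
have /choice [g gP] : forall x : nat * nat, exists u, (0 < x.2)%N -> touch h u = x.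
  move=> [k [|j]] /=; first by exists 0.
  by have [u <-] := touch_surj k j; exists u.
exists g; split=> [u|k j]; last exact: gP.
by apply: touch_inj; apply: gP.
Qed.

End touches.

Lemma increasing_bracket (f : nat -> nat) : f 0 = 0 ->
  (forall m n, (m < n)%N -> (f m < f n)%N) ->
  forall i, exists j, (f j <= i < f j.+1)%N.
Proof.
move=> f0 fM; elim=> [|i [j /andP[ji ij]]].
  by exists 0; have := fM 0 1; rewrite f0 => ->.
case: (leqP (f j.+1) i.+1) => h; last by exists j; lia.
by exists j.+1; have := fM j.+1 j.+2 (ltnSn _); lia.
Qed.

Section subdivision.
Variables (V : Type) (D : digraph V) (r : nat -> nat -> V) (h ell : nat -> nat).
Variables (p : nat -> nat -> V) (pos : nat -> nat) (H : digraph (nat * nat)).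
Hypothesis JS : jump_system D r h ell p pos.
Hypothesis hne : forall t, h t.*2 <> h t.*2.+1.
Hypothesis hinf : forall k n, exists2 u, (n <= u)%N & h u = k.
Hypothesis Hedge : forall x y, edge H x y <->
  (y = (x.1, x.2.+1) \/ exists t, x = touch h t.*2 /\ y = touch h t.*2.+1).

Lemma quarter_grid_subdivision : exists D' phi P,
  [/\ subgraph D' D, subdivision H D' phi P &
      forall k, (0 < k)%N -> subdivided P (column k) = out_ray_of (r k.-1)].
Proof.
have [g [gK gP]] := touch_inverse hinf.
have rI := js_rays JS.
(* The position on ray [k] of the branch vertex with index [j]; index 0 is the root, every other one
   a jump endpoint. *)
pose nu k j := if j is _.+1 then pos (g (k, j)) else 0.
have nuT u : nu (h u) (touch h u).2 = pos u by rewrite /nu /= gK.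
have nuM k : forall m n, (m < n)%N -> (nu k m < nu k n)%N.
  move=> [|m] [|n] // mn; first exact: (js_pos_gt0 JS).
  rewrite /nu; have em := gP k m; have en := gP k n.
  have hm : h (g (k, m.+1)) = k by case: em.
  have hn : h (g (k, n.+1)) = k by case: en.
  apply: (js_pos JS); last by rewrite hm hn.
  case: (ltngtP (g (k, m.+1)) (g (k, n.+1))) => // [c|c].
    by have := touch_mono (h := h) c; rewrite hm hn em en => /(_ erefl) /=; lia.
  by move: em; rewrite c en => -[]; lia.
have nu0 k : nu k 0 = 0 by [].
clearbody nu.
have nuMI k m n : (nu k m < nu k n)%N -> (m < n)%N.
  by rewrite ltnNge; case: ltnP => //; rewrite leq_eqVlt => /orP[/eqP->|/(nuM k)];
    rewrite ?leqnn // => /ltnW->.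
have nuI k : injective (nu k) := strict_mono_inj (nuM k).
pose phi (x : nat * nat) := r x.1 (nu x.1 x.2).
have phiT u : phi (touch h u) = r (h u) (pos u) by rewrite /phi nuT.
have phiI : injective phi by move=> [k j] [k' j'] /rI /= [-> /nuI ->].
(* A jump always changes the ray, so comparing first coordinates separates vertical edges from
   jumps. The start of jump [t] is touch [t.*2], so halving its time recovers [t]. *)
pose P (e : (nat * nat) * (nat * nat)) :=
  if e.1.1 == e.2.1
  then path_of (nu e.1.1 e.2.2 - nu e.1.1 e.1.2) (fun i => r e.1.1 (nu e.1.1 e.1.2 + i))
  else path_of (ell (g e.1)./2) (p (g e.1)./2).
have Pray k j : P ((k, j), (k, j.+1)) =
    path_of (nu k j.+1 - nu k j) (fun i => r k (nu k j + i)).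
  by rewrite /P /= eqxx.
have Pjump t : P (touch h t.*2, touch h t.*2.+1) = path_of (ell t) (p t).
  by rewrite /P /= (negbTE (introN eqP (@hne t))) gK doubleK.
have Hcase e : edge_set H e -> (exists k j, e = ((k, j), (k, j.+1))) \/
    exists t, e = (touch h t.*2, touch h t.*2.+1).
  case: e => -[k j] y /Hedge[/= ->|[t [/= -> ->]]]; first by left; exists k, j.
  by right; exists t.
have inner_ray k j v : inner_verts phi P ((k, j), (k, j.+1)) v ->
    exists2 i, (nu k j < i < nu k j.+1)%N & v = r k i.
  rewrite /inner_verts Pray => -[[i /= ik <-] /not_orP[n1 n2]].
  have k1 := nuM k _ _ (ltnSn j).
  exists (nu k j + i)%N => //.
  have [i0|i0] := posnP i; first by case: n1; rewrite i0 addn0.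
  case: (ltngtP i (nu k j.+1 - nu k j)) => c; [lia|lia|].
  by case: n2; rewrite c subnKC // ltnW.
have inner_jump t v : inner_verts phi P (touch h t.*2, touch h t.*2.+1) v ->
    exists2 i, (0 < i < ell t)%N & v = p t i.
  rewrite /inner_verts Pjump /= !phiT -(js_start JS) -(js_end JS).
  move=> [[i /= il <-] /not_orP[n1 n2]]; exists i => //.
  have [i0|i0] := posnP i; first by case: n1; rewrite i0.
  by case: (ltngtP i (ell t)) => c; [|lia|case: n2; rewrite c].
have Pdipath e : edge_set H e -> dipath (P e) (phi e.1) (phi e.2).
  move=> /Hcase[[k [j ->]]|[t ->]].
    have k1 := nuM k _ _ (ltnSn j).
    exists (nu k j.+1 - nu k j)%N, (fun i => r k (nu k j + i)); split.
    - by move=> a b _ _ /rI[_ /addnI].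
    - exact: Pray.
    - by rewrite addn0.
    - by rewrite subnKC // ltnW.
  exists (ell t), (p t); split.
  - by move=> a b; rewrite !inE /= => al bl /(js_inj JS)[].
  - exact: Pjump.
  - by rewrite phiT (js_start JS).
  - by rewrite phiT (js_end JS).
have PD e : edge_set H e -> forall u v, edge (P e) u v -> edge D u v.
  move=> /Hcase[[k [j ->]]|[t ->]] u v.
    by rewrite Pray => -[i _ [-> ->]]; rewrite addnS; exact: (js_ray_edge JS).
  by rewrite Pjump => -[i il [-> ->]]; exact: (js_edge JS).
have PDv e : edge_set H e -> forall v, verts (P e) v -> verts D v.
  move=> /Hcase[[k [j ->]]|[t ->]] v.
    rewrite Pray => -[i _ <-].
    by have [] := edge_verts (js_ray_edge JS k (nu k j + i)).
  rewrite Pjump => -[i /= il <-].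
  case: (ltngtP i (ell t)) => c; [|lia|].
    by have [] := edge_verts (js_edge JS c).
  rewrite c (js_end JS).
  by have [] := edge_verts (js_ray_edge JS (h t.*2.+1) (pos t.*2.+1)).
exists (dunion (edgeless (phi @` verts H)) (bigunion (edge_set H) P)), phi, P.
split.
- split=> [v [[x _ <-]|[e /PDv]]|u v [//|[e /PD]]]; [|exact|exact].
  by have [] := edge_verts (js_ray_edge JS x.1 (nu x.1 x.2)).
- split=> //.
  + by move=> x y _ _; exact: phiI.
  + move=> e He; rewrite -subset0 => v [iv [[k' j'] _ e']].
    case: (Hcase _ He) iv => [[k [j ->]]|[t ->]].
      move=> /inner_ray[i /andP[i1 i2] vi].
      move: vi; rewrite -e' => /rI /= [kk ii].
      by move: i1 i2; rewrite -ii kk => /nuMI ? /nuMI ?; lia.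
    move=> /inner_jump[i il vi].
    by case: (js_inner JS (k := k') (j := nu k' j') il); rewrite -vi -e'.
  + move=> e e' He He' [v [iv iv']].
    case: (Hcase _ He) (Hcase _ He') iv iv' => [[k [j ->]]|[t ->]] [[k' [j' ->]]|[t' ->]].
    * move=> /inner_ray[i /andP[i1 i2] ->] /inner_ray[i' /andP[i1' i2'] /rI[kk ii]].
      subst k' i'.
      have : (nu k j < nu k j'.+1)%N by lia.
      have : (nu k j' < nu k j.+1)%N by lia.
      by move=> /nuMI ? /nuMI ?; have -> : j = j' by lia.
    * move=> /inner_ray[i _ ->] /inner_jump[i' il /esym].
      by move=> /(js_inner JS il).
    * by move=> /inner_jump[i' il ->] /inner_ray[i _ /(js_inner JS il)].
    * move=> /inner_jump[i il ->] /inner_jump[i' il' e0].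
      by have [||-> _] := js_inj JS _ _ e0; [lia|lia|].
- case=> // k _ /=; apply: digraph_ext => [v|u v] /=; split.
  + move=> [[x y] [j /= [-> ->]]]; rewrite Pray => -[i _ <-].
    by exists (nu k j + i)%N.
  + move=> [i _ <-]; have [j ji] := increasing_bracket (nu0 k) (nuM k) i.
    exists ((k, j), (k, j.+1)); first by exists j.
    by rewrite Pray; exists (i - nu k j)%N => /=; [lia|rewrite subnKC //; lia].
  + move=> [[x y] [j /= [-> ->]]]; rewrite Pray => -[i _ [-> ->]].
    by exists (nu k j + i)%N; rewrite addnS.
  + move=> [i [-> ->]].
    have [j ji] := increasing_bracket (nu0 k) (nuM k) i.
    exists ((k, j), (k, j.+1)); first by exists j.
    rewrite Pray; exists (i - nu k j)%N; first lia.
    by rewrite addnS subnKC; [|lia].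
Qed.

End subdivision.

(** * Girders *)

Lemma path_of_cat (V : Type) (q : nat -> V) m n :
  path_of (m + n).+1 q =
  dunion (dunion (path_of m q) (arc (q m) (q m.+1)))
    (path_of n (fun i => q (m.+1 + i))).
Proof.
apply: digraph_ext => [v|u v] /=; split.
- move=> [i /= im <-]; case: (leqP i m) => h; first by left; left; exists i.
  by right; exists (i - m.+1)%N => /=; [lia|rewrite subnKC].
- move=> [[[i /= im <-]|[->|->]]|[i /= im <-]].
  + by exists i => //=; lia.
  + by exists m => //=; lia.
  + by exists m.+1 => //=; lia.
  + by exists (m.+1 + i)%N => //=; lia.
- move=> [i im [-> ->]]; case: (ltngtP i m) => h.
  + by left; left; exists i.
  + by right; exists (i - m.+1)%N; [lia|rewrite addnS !subnKC].
  + by left; right; rewrite h.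
- move=> [[[i im [-> ->]]|[-> ->]]|[i im [-> ->]]].
  + by exists i => //; lia.
  + by exists m => //; lia.
  + by exists (m.+1 + i)%N; [lia|rewrite addnS].
Qed.

Lemma path_of1 (V : Type) (q : nat -> V) : path_of 1 q = arc (q 0) (q 1).
Proof.
apply: digraph_ext => [v|u v] /=; split.
- by move=> [[|[|i]] //= _ <-]; [left|right].
- by case=> ->; [exists 0|exists 1].
- by move=> [[|i] // _].
- by move=> [-> ->]; exists 0.
Qed.

(** The form required by [simple_staircase] with [m.+1] rays: edges at even places are the jumps
    [P_j], those at odd places the vertical edges [Q_j]. *)
Lemma path_of_alternating (V : Type) (q : nat -> V) m : (0 < m)%N ->
  path_of m.*2.-1 q =
  dunion (bigunion [set j | (1 <= j < m.+1)%N]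
            (fun j => arc (q j.-1.*2) (q j.-1.*2.+1)))
         (bigunion [set j | (2 <= j < m.+1)%N]
            (fun j => arc (q j.-2.*2.+1) (q j.-1.*2))).
Proof.
move=> m0; apply: digraph_ext => [v|u v] /=; split.
- move=> [i /= im <-]; left; exists i./2.+1 => /=; first by lia.
  by rewrite -[in q i](odd_double_half i); case: odd; [right|left].
- move=> [[j /= jm [->|->]]|[j /= jm [->|->]]].
  + by exists j.-1.*2 => //=; lia.
  + by exists j.-1.*2.+1 => //=; lia.
  + by exists j.-2.*2.+1 => //=; lia.
  + by exists j.-1.*2 => //=; lia.
- move=> [i im [-> ->]]; case io : (odd i); [right|left].
    exists i./2.+2 => /=; first lia.
    by split; congr q; lia.
  exists i./2.+1 => /=; first lia.
  by split; congr q; lia.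
- move=> [[j /= jm [-> ->]]|[j /= jm [-> ->]]].
  + by exists j.-1.*2 => //; lia.
  + by exists j.-2.*2.+1; [lia|split=> //; congr q; lia].
Qed.

Lemma column_verts k x : verts (column k) x <-> x.1 = k.-1.
Proof. by split=> [[j _ <-]//|]; case: x => a j /= ->; exists j. Qed.

Lemma column_edge k x y :
  edge (column k) x y <-> x.1 = k.-1 /\ y = (x.1, x.2.+1).
Proof.
split=> [[j [-> ->]]//|[]]; case: x => a j /= -> ->; by exists j.
Qed.

Section staircases.
Variable h : nat -> nat.

Let q u := touch h u.

(** This makes staircases simple: a jump that starts on the ray where the previous one landed does
    so exactly one vertical edge later. *)
Lemma touch_next u : h u.+1 = h u -> q u.+1 = ((q u).1, (q u).2.+1).
Proof. by rewrite /q /touch => -> /=; rewrite label_countS eqxx addn1. Qed.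

Lemma touch_edge k u : (0 < k)%N -> h u = k.-1 -> h u.+1 = k.-1 ->
  edge (column k) (q u) (q u.+1).
Proof. by move=> k0 h1 h2; apply/column_edge; rewrite touch_next ?h1 ?h2. Qed.

Definition touch_path s l := path_of l (fun i => q (s.*2 + i)).

Lemma touch_path_staircase s n (ix : nat -> nat) : (2 <= n)%N ->
  (forall j, (0 < j <= n)%N -> (0 < ix j)%N) ->
  (forall j, (j < n.-1)%N -> h (s + j).*2 = (ix j.+1).-1 /\
                             h (s + j).*2.+1 = (ix j.+2).-1) ->
  simple_staircase column n ix (touch_path s n.-1.*2.-1)
    (q s.*2) (q (s + n.-2).*2.+1).
Proof.
case: n => [|[|n]] //= _ ix0 hs; split.
  exists n.+1.*2.-1, (fun i => q (s.*2 + i)); split=> //.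
  - by move=> i j _ _ /touch_inj /addnI.
  - by rewrite addn0.
  - by congr q; lia.
exists (fun j => q (s + j.-1).*2), (fun j => q (s + j.-1).*2.+1); split.
- move=> [|j] //= jn; have [|h1 h2] := hs j; first lia.
  by split; apply/column_verts.
- move=> [|[|j]] //= jn.
  have [|_ h1] := hs j; first lia.
  have [|h2 _] := hs j.+1; first lia.
  have e : (s + j.+1).*2 = (s + j).*2.+2 by lia.
  by rewrite e in h2 *; apply: touch_edge => //; apply: ix0; lia.
- by rewrite addn0.
- by [].
- rewrite /touch_path -[X in path_of X]/(n.+1.*2.-1) path_of_alternating //.
  congr dunion; congr bigunion; apply/funext => j.
    by congr arc; congr q; lia.
  by congr arc; congr q; lia.
Qed.

(** Along a column touches occur in the order of time, so a later touch cannot lie below an earlier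
    one. *)
Lemma touch_not_below X u' : (forall x, X x -> exists2 u, (u < u')%N & x = q u) ->
  ~ down_closure column X (q u').
Proof.
move=> Xu [/Xu[u uu' /touch_inj e]|]; first by rewrite e ltnn in uu'.
move=> [i [i0 _ [Q [[r [_ -> r0]] [_ rsub] [x [[k _ <-] /Xu[u uu' rk]]]]]]].
have rE : r k = ((q u').1, (q u').2 + k)%N.
  elim: k {rk} => [|k IH]; first by rewrite addn0 r0; case: (q u').
  have /rsub/column_edge[_ ->] : edge (out_ray_of r) (r k) (r k.+1) by exists k.
  by rewrite IH addnS.
have e := esym rk; rewrite rE in e.
have hu : h u = h u' by case: e.
have := touch_mono uu' hu; rewrite -/(q u) e /= -/(q u').
by rewrite ltnNge leq_addr.
Qed.

Lemma touch_path_avoids s l X : (forall x, X x -> exists2 u, (u < s.*2)%N & x = q u) ->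
  avoids (touch_path s l) (down_closure column X).
Proof.
move=> Xs; rewrite /avoids -subset0 => x [[i _ <-]]; apply: touch_not_below => y.
by move=> /Xs[u us ->]; exists u => //; lia.
Qed.

Lemma touch_path_before s l s' : (s.*2 + l < s'.*2)%N ->
  forall x, verts (touch_path s l) x -> exists2 u, (u < s'.*2)%N & x = q u.
Proof. by move=> ss' x [i /= il <-]; exists (s.*2 + i)%N => //; lia. Qed.

End staircases.

(* Girder [n] is the sequence of jumps between rays
   [c n 0 -> c n 1 -> ... -> c n (len n)]; rays are numbered from [0]. *)
Record schedule (len : nat -> nat) (c : nat -> nat -> nat) : Prop := {
  sch_len0 : forall n, (n < 2)%N -> len n = 0;
  sch_len : forall n, (2 <= n)%N -> (0 < len n)%N;
  sch_lt : forall n k, (2 <= n)%N -> (k <= len n)%N -> (c n k < n)%N;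
  sch_ne : forall n k, (2 <= n)%N -> (k < len n)%N -> c n k <> c n k.+1;
  sch_all : forall n k, (2 <= n)%N -> (k < n)%N ->
    exists2 i, (i < len n)%N & c n i = k }.

(** The index of the first jump of girder [n]. *)
Definition block (len : nat -> nat) (n : nat) : nat := \sum_(m < n) len m.

Record schedule_labels (len : nat -> nat) (c : nat -> nat -> nat)
    (h N : nat -> nat) : Prop := {
  lab_start : forall n k, (k < len n)%N -> h (block len n + k).*2 = c n k;
  lab_end : forall n k, (k < len n)%N -> h (block len n + k).*2.+1 = c n k.+1;
  lab_block : forall n k, (k < len n)%N -> N (block len n + k) = n;
  lab_time : forall t, exists n k, (k < len n)%N /\ t = (block len n + k)%N }.

Section schedules.
Variables (len : nat -> nat) (c : nat -> nat -> nat).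
Hypothesis S : schedule len c.

Lemma blockS n : block len n.+1 = (block len n + len n)%N.
Proof. by rewrite /block big_ord_recr. Qed.

Lemma block_mono m n : (m <= n)%N -> (block len m <= block len n)%N.
Proof.
elim: n => [|n IH]; first by rewrite leqn0 => /eqP->.
rewrite leq_eqVlt blockS => /orP[/eqP->|/IH]; first by rewrite blockS.
by move=> /leq_trans; apply; exact: leq_addr.
Qed.

Lemma block_time t : exists n k, (k < len n)%N /\ t = (block len n + k)%N.
Proof.
have [n /andP[n1 n2]] : exists n, (block len n <= t < block len n.+1)%N.
  elim: t => [|t [n /andP[h1 h2]]].
    (* Girders 0 and 1 are empty, so time 0 belongs to girder 2. *)
    exists 2; rewrite !blockS /block big_ord0 (sch_len0 S) // (sch_len0 S) //=.
    by rewrite (sch_len S).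
  case: (leqP (block len n.+1) t.+1) => h3; last by exists n; lia.
  have n2 : (2 <= n.+1)%N.
    rewrite ltnNge leq_eqVlt ltnS leqn0; apply/negP => n1.
    by move: h1 h2; rewrite blockS (sch_len0 S); lia.
  by exists n.+1; rewrite h3 blockS; have := sch_len S n2; lia.
by exists n, (t - block len n)%N; rewrite blockS in n2; lia.
Qed.

Lemma block_inj n k n' k' : (k < len n)%N -> (k' < len n')%N ->
  (block len n + k)%N = (block len n' + k')%N -> n = n' /\ k = k'.
Proof.
move=> kn kn' e; case: (ltngtP n n') => [/block_mono|/block_mono|nn'].
- by rewrite blockS; lia.
- by rewrite blockS; lia.
- by subst n'; split=> //; lia.
Qed.

Lemma len_ge2 n k : (k < len n)%N -> (2 <= n)%N.
Proof. by case: (leqP 2 n) => // /(sch_len0 S) ->. Qed.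

Lemma schedule_labels_exist : exists h N, schedule_labels len c h N.
Proof.
have /choice [f fP] : forall t, exists nk : nat * nat,
    (nk.2 < len nk.1)%N /\ t = (block len nk.1 + nk.2)%N.
  by move=> t; have [n [k nk]] := block_time t; exists (n, k).
have fE n k : (k < len n)%N -> f (block len n + k)%N = (n, k).
  move=> kn; case: (f _) (fP (block len n + k)%N) => n' k' /= [kn' e].
  by have [-> ->] := block_inj kn kn' e.
exists (fun u => c (f u./2).1 ((f u./2).2 + odd u)), (fun t => (f t).1); split.
- by move=> n k kn; rewrite doubleK odd_double fE //= addn0.
- by move=> n k kn; rewrite /= uphalf_double odd_double fE //= addn1.
- by move=> n k kn; rewrite fE.
- exact: block_time.
Qed.

Variables (h N : nat -> nat).
Hypothesis L : schedule_labels len c h N.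

Lemma lab_ne t : h t.*2 <> h t.*2.+1.
Proof.
have [n [k [kn ->]]] := lab_time L t.
by rewrite (lab_start L) // (lab_end L) //; apply: (sch_ne S) => //; exact: len_ge2 kn.
Qed.

Lemma lab_lt t : (h t.*2 < N t)%N /\ (h t.*2.+1 < N t)%N.
Proof.
have [n [k [kn ->]]] := lab_time L t.
rewrite (lab_start L) // (lab_end L) // (lab_block L) //.
by split; apply: (sch_lt S); rewrite ?(len_ge2 kn) //; exact: ltnW.
Qed.

Lemma lab_block_mono t t' : (t <= t')%N -> (N t <= N t')%N.
Proof.
have [n [k [kn ->]]] := lab_time L t; have [n' [k' [kn' ->]]] := lab_time L t'.
rewrite !(lab_block L) // => tt'; rewrite leqNgt; apply/negP => /block_mono.
by rewrite blockS; lia.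
Qed.

Lemma lab_block_unbounded k : exists t, (k < N t)%N.
Proof.
exists (block len k.+2 + 0)%N; rewrite (lab_block L) //; exact: (sch_len S).
Qed.

(** Every girder [m > k] with [m >= 2] starts a jump on ray [k], and by then at least [m - 2] jumps
    have been made. *)
Lemma lab_infinite k n : exists2 u, (n <= u)%N & h u = k.
Proof.
pose m := (n + k).+2.
have [//||i il ci] := @sch_all _ _ S m k; first by rewrite /m; lia.
exists (block len m + i).*2; last by rewrite (lab_start L).
suff H x : (x <= block len x.+2)%N by have := H (n + k)%N; rewrite -/m; lia.
elim: x => // x IH; rewrite blockS.
by have := @sch_len _ _ S x.+2 isT; lia.
Qed.

Definition girder (n : nat) := touch_path h (block len n) (len n).*2.-1.

Definition grid : digraph (nat * nat) :=
  dunion (bigunion [set i | (0 < i)%N] column) (bigunion [set n | (1 < n)%N] girder).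

(** The vertical edges of the girders already lie on the columns, so only the jumps are new. *)
Lemma grid_edge x y : edge grid x y <->
  (y = (x.1, x.2.+1) \/ exists t, x = touch h t.*2 /\ y = touch h t.*2.+1).
Proof.
split.
  move=> [[i _ /column_edge[_ ->]]|[n /= n2 [i il [-> ->]]]]; first by left.
  case io : (odd i); [left|right]; last first.
    by exists (block len n + i./2)%N; split; congr touch; lia.
  rewrite addnS touch_next //.
  have -> : ((block len n).*2 + i).+1 = (block len n + i./2.+1).*2 by lia.
  have -> : ((block len n).*2 + i)%N = (block len n + i./2).*2.+1 by lia.
  by rewrite (lab_start L) ?(lab_end L) //; lia.
move=> [->|[t [-> ->]]].
  by left; exists x.1.+1 => //; apply/column_edge.
have [n [k [kn ->]]] := lab_time L t.
right; exists n; first exact: len_ge2 kn.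
exists k.*2; first lia.
by split; congr touch; lia.
Qed.

Lemma grid_rays_with_girders : rays_with_girders grid column girder.
Proof.
split=> //.
- by move=> i i0; exists (i.-1, 0), (fun j => (i.-1, j)); split=> // a b [].
- by move=> i j /= i0 j0 [x [/column_verts xi /column_verts xj]]; lia.
- move=> i n /andP[i2 iltn]; apply: touch_path_avoids.
  apply: touch_path_before; have := block_mono iltn; rewrite blockS.
  by have := sch_len S i2; lia.
(* A root has no in-edge. Any other vertex is a touch: the end of a jump has a second in-edge, the
   start of a jump a second out-edge, coming from or leading to another column. *)
- move=> [k [|j]] _ [[x [xv xU]] [y [vy yU]]].
    by move/grid_edge: xv => [//|[t [_ []]]].
  have [u uE] := touch_surj lab_infinite k j.
  have := odd_double_half u; case: odd; rewrite ?add0n ?add1n => e.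
    have x1 : x = (k, j) by apply: xU; apply/grid_edge; left.
    have x2 : x = touch h u./2.*2.
      by apply: xU; apply/grid_edge; right; exists u./2; rewrite e uE.
    move: x2 uE; rewrite x1 -{2}e => -[-> _] [/esym].
    by move=> /lab_ne.
  have y1 : y = (k, j.+2) by apply: yU; apply/grid_edge; left.
  have y2 : y = touch h u./2.*2.+1.
    by apply: yU; apply/grid_edge; right; exists u./2; rewrite e uE.
  move: y2 uE; rewrite y1 -{2}e => -[-> _] [].
  by move=> /lab_ne.
- move=> i v n i0 n2 [r [rI iE r0]] [l _ vE].
  have [k _ kE] : verts (out_ray_of r) (i.-1, 0) by rewrite -iE; apply/column_verts.
  case: k kE => [|k] kE; first by move: kE; rewrite r0 -vE.
  have : edge (column i) (r k) (r k.+1) by rewrite iE; exists k.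
  by move=> /column_edge[_]; rewrite kE.
Qed.

End schedules.

Definition bidirected_len (n : nat) := n.-1.*2.
(** The sequence 0, 1, ..., n-1, ..., 1, 0. *)
Definition bidirected_seq (n k : nat) := minn k (n.-1.*2 - k).
Definition cyclic_len (n : nat) := if (1 < n)%N then n else 0.
Definition ascending_seq (n k : nat) := if (k < n)%N then k else 0.
(** The sequence 0, n-1, n-2, ..., 1, 0. *)
Definition descending_seq (n k : nat) := if k is 0 then 0 else (n - k)%N.

Lemma bidirected_schedule : schedule bidirected_len bidirected_seq.
Proof.
rewrite /bidirected_len /bidirected_seq; split; try by move=> *; lia.
by move=> n k n2 kn; have [kn'|kn'] := ltnP k n.-1;
  [exists k|exists n.-1]; lia.
Qed.

Lemma ascending_schedule : schedule cyclic_len ascending_seq.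
Proof.
rewrite /cyclic_len /ascending_seq; split.
- by move=> n; case: ltnP.
- by move=> n n2; rewrite n2; lia.
- by move=> n k n2 _; case: ifP; lia.
- by move=> n k n2; rewrite n2 => kn; rewrite kn; case: ltnP; lia.
- by move=> n k n2 kn; exists k; rewrite ?n2 ?kn.
Qed.

Lemma descending_schedule : schedule cyclic_len descending_seq.
Proof.
rewrite /cyclic_len /descending_seq; split.
- by move=> n; case: ltnP.
- by move=> n n2; rewrite n2; lia.
- by move=> n [|k] n2 _; lia.
- by move=> n [|k] n2; rewrite n2 => kn; lia.
- move=> n [|k] n2 kn; first by exists 0; rewrite ?n2; lia.
  exists (n - k.+1)%N; rewrite ?n2; first lia.
  by case e : (n - k.+1)%N; lia.
Qed.

Section grids.
Variables (h N : nat -> nat).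

Lemma bidirected_grid : schedule_labels bidirected_len bidirected_seq h N ->
  bidirected_quarter_grid (grid bidirected_len h) column.
Proof.
move=> L; exists (girder bidirected_len h); split.
  exact: (grid_rays_with_girders bidirected_schedule L).
move=> n n2; set b := block bidirected_len n.
have lab k : (k < n.-1.*2)%N -> h (b + k).*2 = minn k (n.-1.*2 - k) /\
    h (b + k).*2.+1 = minn k.+1 (n.-1.*2 - k.+1).
  by move=> kn; rewrite (lab_start L) // (lab_end L).
(* Jump [b + n.-1] is the first one of the descent. *)
exists (touch_path h b n.-1.*2.-1), (touch_path h (b + n.-1) n.-1.*2.-1).
exists (touch h b.*2), (touch h (b + n.-2).*2.+1).
exists (touch h (b + n.-1).*2), (touch h (b + n.-1 + n.-2).*2.+1); split.
- apply: touch_path_staircase => // [j /andP[]//|j jn].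
  by have [|-> ->] := lab j; lia.
- have e : (b + n.-1).*2 = (b + n.-2).*2.+2 by lia.
  have [|h1 _] := lab n.-1; first lia.
  have [|_ h2] := lab n.-2; first lia.
  by rewrite e in h1 *; apply: touch_edge; lia.
- apply: touch_path_staircase => // [j jn|j jn]; first lia.
  by rewrite -addnA; have [|-> ->] := lab (n.-1 + j)%N; lia.
- by apply: touch_path_avoids; apply: touch_path_before; lia.
- rewrite /girder /touch_path -/b.
  have -> : (bidirected_len n).*2.-1 = (n.-1.*2.-1 + n.-1.*2.-1).+1.
    by rewrite /bidirected_len; lia.
  rewrite path_of_cat; congr dunion.
    by congr dunion; congr arc; congr touch; lia.
  by congr path_of; apply/funext => i; congr touch; lia.
Qed.

Lemma ascending_grid : schedule_labels cyclic_len ascending_seq h N ->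
  ascending_cyclic_quarter_grid (grid cyclic_len h) column.
Proof.
move=> L; exists (girder cyclic_len h); split.
  exact: (grid_rays_with_girders ascending_schedule L).
move=> n n2; set b := block cyclic_len n.
have lenE : cyclic_len n = n by rewrite /cyclic_len n2.
have lab k : (k < n)%N -> h (b + k).*2 = k /\
    h (b + k).*2.+1 = if (k.+1 < n)%N then k.+1 else 0.
  move=> kn; rewrite (lab_start L) ?lenE // (lab_end L) ?lenE //.
  by rewrite /ascending_seq kn.
have [|h1 h3] := lab n.-1; first lia.
exists (touch_path h b n.-1.*2.-1), (touch h b.*2), (touch h (b + n.-2).*2.+1).
exists (touch h (b + n.-1).*2), (touch h (b + n.-1).*2.+1).
have arcE : arc (touch h (b + n.-1).*2) (touch h (b + n.-1).*2.+1) =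
    touch_path h (b + n.-1) 1.
  by rewrite /touch_path path_of1; congr arc; congr touch; lia.
split.
- apply: touch_path_staircase => // [j /andP[]//|j jn].
  have [|-> ->] := lab j; first lia.
  by split=> //; case: ifP; lia.
- have e : (b + n.-1).*2 = (b + n.-2).*2.+2 by lia.
  have [|_ h2] := lab n.-2; first lia.
  rewrite e in h1 *; apply: touch_edge; rewrite ?h1 ?h2 //; first lia.
  by case: ifP; lia.
- split; apply/column_verts; rewrite /touch //= h3.
  by case: ifP; lia.
- by rewrite arcE; apply: touch_path_avoids; apply: touch_path_before; lia.
- rewrite arcE /girder /touch_path -/b lenE.
  have -> : n.*2.-1 = (n.-1.*2.-1 + 1).+1 by lia.
  rewrite path_of_cat; congr dunion.
    by congr dunion; congr arc; congr touch; lia.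
  by congr path_of; apply/funext => i; congr touch; lia.
Qed.

Lemma descending_grid : schedule_labels cyclic_len descending_seq h N ->
  descending_cyclic_quarter_grid (grid cyclic_len h) column.
Proof.
move=> L; exists (girder cyclic_len h); split.
  exact: (grid_rays_with_girders descending_schedule L).
move=> n n2; set b := block cyclic_len n.
have lenE : cyclic_len n = n by rewrite /cyclic_len n2.
have lab k : (k < n)%N -> h (b + k).*2 = (if k is 0 then 0 else (n - k)%N) /\
    h (b + k).*2.+1 = (n - k.+1)%N.
  by move=> kn; rewrite (lab_start L) ?lenE // (lab_end L) ?lenE.
have [|h0 h1] := lab 0; first lia.
have [|h2 _] := lab 1; first lia.
rewrite addn0 in h0 h1.
exists (touch h b.*2), (touch h b.*2.+1), (touch_path h b.+1 n.-1.*2.-1).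
exists (touch h b.+1.*2), (touch h (b.+1 + n.-2).*2.+1).
have arcE : arc (touch h b.*2) (touch h b.*2.+1) = touch_path h b 1.
  by rewrite /touch_path path_of1; congr arc; congr touch; lia.
split.
- split; apply/column_verts; rewrite /touch /= ?h0 ?h1 //; lia.
- have e : b.+1.*2 = b.*2.+2 by lia.
  rewrite addn1 in h2.
  by rewrite e in h2 *; apply: touch_edge; rewrite ?h1 ?h2; lia.
- apply: touch_path_staircase => // [j jn|j jn]; first lia.
  by rewrite addSnnS; have [|-> ->] := lab j.+1; lia.
- by rewrite arcE; apply: touch_path_avoids; apply: touch_path_before; lia.
- rewrite arcE /girder /touch_path -/b lenE.
  have -> : n.*2.-1 = (1 + n.-1.*2.-1).+1 by lia.
  rewrite path_of_cat; congr dunion.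
    by congr dunion; congr arc; congr touch; lia.
  by congr path_of; apply/funext => i; congr touch; lia.
Qed.

End grids.

(** * Quarter-grids from linked rays *)

Lemma grid_subdivision (V : Type) (D : digraph V) (r : nat -> nat -> V) len c :
  disjoint_rays r -> (forall k i, edge D (r k i) (r k i.+1)) ->
  schedule len c ->
  (forall s : nat -> nat, (forall m n, (m < n)%N -> (s m < s n)%N) -> s 0 = 0 ->
    forall n k, (1 < n)%N -> (k < len n)%N ->
      pull s (ray_link D r) (c n k) (c n k.+1)
        [set a | (a < n)%N /\ a <> c n k /\ a <> c n k.+1]) ->
  exists h N, schedule_labels len c h N /\ exists D' phi P,
    [/\ subgraph D' D, subdivision (grid len h) D' phi P &
        forall k, (0 < k)%N -> exists i, subdivided P (column k) = out_ray_of (r i)].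
Proof.
move=> rI rE S lk; have [h [N L]] := schedule_labels_exist S.
exists h, N; split=> //.
have [|s [ell [p [pos [_ JS]]]]] := jump_system_exists rI rE (lab_ne S L)
  (lab_lt S L) (lab_block_mono L) (lab_block_unbounded S L).
  move=> s sM s0 t; have [n [k [kn ->]]] := lab_time L t.
  rewrite (lab_start L) // (lab_end L) // (lab_block L) //.
  by apply: lk => //; exact: len_ge2 S _ _ kn.
have [D' [phi [P [D'D sub PE]]]] := quarter_grid_subdivision JS (lab_ne S L)
  (lab_infinite S L) (grid_edge S L).
exists D', phi, P; split=> // k k0; exists (s k.-1); exact: PE.
Qed.

Lemma pull_ray_link (V : Type) (D : digraph V) (r : nat -> nat -> V) x :
  pull x (ray_link D r) = ray_link D (fun k => r (x k)).
Proof.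
apply/funext => a; apply/funext => b; apply/funext => F.
rewrite /pull /ray_link (_ : rays r (x @` F) = rays (fun k => r (x k)) F) //.
apply/seteqP; split=> [v [_ [f Ff <-] [k ->]]|v [f Ff [k ->]]].
  by exists f => //; exists k.
by exists (x f); [exists f|exists k].
Qed.

Lemma bidirected_chain_schedule A : bidirected_chain A ->
  forall n k, (1 < n)%N -> (k < bidirected_len n)%N ->
    A (bidirected_seq n k) (bidirected_seq n k.+1)
      [set a | (a < n)%N /\ a <> bidirected_seq n k /\ a <> bidirected_seq n k.+1].
Proof.
move=> bA n k n2; rewrite /bidirected_len => kn; set F := [set a | _].
have fF : finite_set F by apply: (@bounded_finite_set _ n) => f [].
case: (ltnP k n.-1) => kn'.
  have [//|||] // := bA (bidirected_seq n k) (bidirected_seq n k.+1) F;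
    rewrite /bidirected_seq; first lia.
  by move=> f [_]; rewrite /bidirected_seq; lia.
have [//|||] // := bA (bidirected_seq n k.+1) (bidirected_seq n k) F;
    rewrite /bidirected_seq; first lia.
by move=> f [_]; rewrite /bidirected_seq; lia.
Qed.

Lemma cyclic_chain_ascending A : cyclic_chain A ->
  forall n k, (1 < n)%N -> (k < cyclic_len n)%N ->
    A (ascending_seq n k) (ascending_seq n k.+1)
      [set a | (a < n)%N /\ a <> ascending_seq n k /\ a <> ascending_seq n k.+1].
Proof.
move=> [A1 A2] n k n2; rewrite /cyclic_len n2 => kn; set F := [set a | _].
have fF : finite_set F by apply: (@bounded_finite_set _ n) => f [].
rewrite {1 2}/ascending_seq kn; case: ltnP => kn'.
  by apply: A1 => // f [_]; rewrite /ascending_seq kn kn'; lia.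
by apply: A2 => [|f []]; [lia|rewrite /ascending_seq kn (leq_gtF kn'); lia].
Qed.

Lemma cyclic_chain_descending A : cyclic_chain (flip A) ->
  forall n k, (1 < n)%N -> (k < cyclic_len n)%N ->
    A (descending_seq n k) (descending_seq n k.+1)
      [set a | (a < n)%N /\ a <> descending_seq n k /\ a <> descending_seq n k.+1].
Proof.
move=> [A1 A2] n k n2; rewrite /cyclic_len n2 => kn; set F := [set a | _].
have fF : finite_set F by apply: (@bounded_finite_set _ n) => f [].
case: k kn @F fF => [|k] kn F fF.
  by apply: A2 => [|f []] /=; lia.
by apply: A1 => // [|f [_]] /=; lia.
Qed.

Lemma linked_rays_quarter_grid (V : Type) (D : digraph V) (r : nat -> nat -> V) :
  disjoint_rays r -> (forall k i, edge D (r k i) (r k i.+1)) ->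
  (forall a b Z, a <> b -> finite_set Z ->
     exists i j, reach D (~` Z) (r a i) (r b j)) ->
  exists D' H phi P,
    [/\ subgraph D' D,
        bidirected_quarter_grid H column \/ cyclic_quarter_grid H column,
        subdivision H D' phi P &
        forall k, (0 < k)%N -> exists i, subdivided P (column k) = out_ray_of (r i)].
Proof.
move=> rI rE lk.
have [x [xM]] := chain_exists (ray_link_linkage rI rE lk).
rewrite pull_ray_link; set r' := fun k => r (x k).
have xI := strict_mono_inj xM.
have r'I : disjoint_rays r' by move=> a i b j /rI[/xI].
have r'E k i : edge D (r' k i) (r' k i.+1) by exact: rE.
have done len c : schedule len c ->
    (forall s : nat -> nat, (forall m n, (m < n)%N -> (s m < s n)%N) -> s 0 = 0 ->
    forall n k, (1 < n)%N -> (k < len n)%N ->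
      pull s (ray_link D r') (c n k) (c n k.+1)
        [set a | (a < n)%N /\ a <> c n k /\ a <> c n k.+1]) ->
    (forall h N, schedule_labels len c h N ->
      bidirected_quarter_grid (grid len h) column \/
      cyclic_quarter_grid (grid len h) column) ->
    exists D' H phi P,
    [/\ subgraph D' D,
        bidirected_quarter_grid H column \/ cyclic_quarter_grid H column,
        subdivision H D' phi P &
        forall k, (0 < k)%N -> exists i, subdivided P (column k) = out_ray_of (r i)].
  move=> S Slk SG.
  have [h [N [L [D' [phi [P [D'D sub PE]]]]]]] := grid_subdivision r'I r'E S Slk.
  exists D', (grid len h), phi, P; split=> //; first exact: SG L.
  by move=> k /PE[i ->]; exists (x i).
case=> ch.
- apply: done bidirected_schedule _ _ => [s sM s0|h N /bidirected_grid]; last by left.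
  by apply: bidirected_chain_schedule; exact: bidirected_chain_pull.
- apply: done ascending_schedule _ _ => [s sM s0|h N /ascending_grid];
    last by right; left.
  by apply: cyclic_chain_ascending; exact: cyclic_chain_pull.
- apply: done descending_schedule _ _ => [s sM s0|h N /descending_grid];
    last by right; right.
  by apply: cyclic_chain_descending; exact: (@cyclic_chain_pull (flip (ray_link D r'))).
Qed.

(** * Reversing all edges *)

Section reversal.
Variable V : Type.

Lemma reach_reverse (D : digraph V) S u v : reach D S u v -> reach (reverse D) S v u.
Proof.
move=> [n [p [[pS pE] p0 pn]]]; exists n, (fun k => p (n - k)); split.
- split=> k kn; first by apply: pS; lia.
  by rewrite /= (_ : (n - k = (n - k.+1).+1)%N); [apply: pE|]; lia.
- by rewrite subn0.
- by rewrite subnn.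
Qed.

Lemma reverse_dipath (Q : digraph V) u v : dipath Q u v -> dipath (reverse Q) v u.
Proof.
move=> [n [p [pI -> p0 pn]]]; exists n, (fun k => p (n - k)); split.
- move=> i j; rewrite !inE /= => i_n j_n /pI; rewrite !inE /= => e.
  by have := e _ _; lia.
- apply: digraph_ext => [w|w z] /=; split.
  + by move=> [k /= kn <-]; exists (n - k) => /=; [lia|rewrite subKn].
  + by move=> [k /= kn <-]; exists (n - k) => //=; lia.
  + move=> [k kn [-> ->]]; exists (n - k.+1); first lia.
    by rewrite -subSn // subSS !subKn // ltnW.
  + move=> [k kn [-> ->]]; exists (n - k.+1); first lia.
    by rewrite -subSn // subSS.
- by rewrite subn0.
- by rewrite subnn.
Qed.

Lemma reverse_subgraph (A B : digraph V) :
  subgraph A B -> subgraph (reverse A) (reverse B).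
Proof. by case=> vAB eAB; split=> // u v /=; exact: eAB. Qed.

Lemma reverseK : involutive (@reverse V).
Proof. by move=> A; apply: digraph_ext. Qed.

Variables (W : Type) (phi : W -> V) (P : W * W -> digraph V).

Definition reverse_paths (e : W * W) := reverse (P (e.2, e.1)).

Lemma reverse_subdivided (A : digraph W) :
  subdivided reverse_paths (reverse A) = reverse (subdivided P A).
Proof.
apply: digraph_ext => [v|u v] /=; split=> -[[x y] /= xy h];
  by exists (y, x).
Qed.

Lemma reverse_subdivision (H : digraph W) (D : digraph V) :
  subdivision H D phi P -> subdivision (reverse H) (reverse D) phi reverse_paths.
Proof.
move=> [phiI Pd Pi Pt De].
have iE e : inner_verts phi reverse_paths e = inner_verts phi P (e.2, e.1).
  by rewrite /inner_verts /= setUC.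
split=> //.
- by move=> e He; apply: reverse_dipath; exact: (Pd (e.2, e.1)).
- by move=> e He; rewrite iE; exact: (Pi (e.2, e.1)).
- move=> [x y] [x' y'] He He'; rewrite !iE => ee.
  by have [-> ->] := Pt (y, x) (y', x') He He' ee.
- rewrite De; apply: digraph_ext => [v|u v] /=; split.
  + by move=> [|[[x y] /= xy h]]; [left|right; exists (y, x)].
  + by move=> [|[[x y] /= xy h]]; [left|right; exists (y, x)].
  + by move=> [//|[[x y] /= xy h]]; right; exists (y, x).
  + by move=> [//|[[x y] /= xy h]]; right; exists (y, x).
Qed.

End reversal.

Lemma infinite_injection (I : Type) : infinite_set [set: I] ->
  exists f : nat -> I, injective f.
Proof.
move=> /infiniteP/card_leP[g].
exists (fun n => val (g (SigSub (mem_set (Logic.I : [set: nat] n))))) => m n.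
by move=> /val_inj /(@inj _ _ _ g _ _ (mem_set Logic.I) (mem_set Logic.I)) /(congr1 val).
Qed.

Theorem theorem1p2 (V : Type) (D : digraph V) :
  (forall (I : Type) (R : I -> digraph V),
    infinite_set [set: I] ->
    (forall i, out_ray (R i) /\ subgraph (R i) D) ->
    trivIset [set: I] (fun i => verts (R i)) ->
    (forall i j, i <> j -> equivalent_rays D (R i) (R j)) ->
    exists D' : digraph V, subgraph D' D /\
      exists (W : Type) (H : digraph W) (VR : nat -> digraph W)
             (phi : W -> V) (P : W * W -> digraph V),
        [/\ bidirected_quarter_grid H VR \/ cyclic_quarter_grid H VR,
            subdivision H D' phi P &
            forall n, (0 < n)%N -> exists i, subdivided P (VR n) = R i])
  /\
  (forall (I : Type) (R : I -> digraph V),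
    infinite_set [set: I] ->
    (forall i, in_ray (R i) /\ subgraph (R i) D) ->
    trivIset [set: I] (fun i => verts (R i)) ->
    (forall i j, i <> j -> equivalent_rays D (R i) (R j)) ->
    exists D' : digraph V, subgraph D' D /\
      exists (W : Type) (H : digraph W) (VR : nat -> digraph W)
             (phi : W -> V) (P : W * W -> digraph V),
        [/\ reversed_bidirected_quarter_grid H VR \/
              reversed_cyclic_quarter_grid H VR,
            subdivision H D' phi P &
            forall n, (0 < n)%N -> exists i, subdivided P (VR n) = R i]).
Proof.
split=> I R iI RR tR eR; have [f fI] := infinite_injection iI.
- have /choice [r rP] : forall n, exists r : nat -> V,
      injective r /\ R (f n) = out_ray_of r.
    by move=> n; have [[v [r [rI eRr _]]] _] := RR (f n); exists r.
  have rI : disjoint_rays r.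
    move=> a i b j ab; suff e : a = b.
      by subst b; split=> //; have [rI _] := rP a; exact: rI.
    apply: fI; apply: tR => //; exists (r a i); split.
      by rewrite (proj2 (rP a)); exists i.
    by rewrite (proj2 (rP b)) ab; exists j.
  have rE k i : edge D (r k i) (r k i.+1).
    have [_ [_ sub]] := RR (f k); apply: sub.
    by rewrite (proj2 (rP k)); exists i.
  have [|D' [H [phi [P [D'D HG sub PE]]]]] := linked_rays_quarter_grid rI rE.
    move=> a b Z ab fZ; have [ab_paths _] := eR (f a) (f b) (contra_not (@fI a b) ab).
    have [u [v []]] := disjoint_paths_avoid ab_paths fZ.
    rewrite (proj2 (rP a)) (proj2 (rP b)) => -[i _ <-] [j _ <-] ij.
    by exists i, j.
  exists D'; split=> //; exists _, H, column, phi, P; split=> // n /PE[i ->].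
  by exists (f i); rewrite (proj2 (rP i)).
(* The in-rays of [D] are out-rays of [reverse D]. The paths of [D] from ray [b] to ray [a] become
   the links from [a] to [b] there, and the resulting subdivision is reversed back. *)
- have /choice [r rP] : forall n, exists r : nat -> V,
      injective r /\ R (f n) = in_ray_of r.
    by move=> n; have [[r rr] _] := RR (f n); exists r.
  have rI : disjoint_rays r.
    move=> a i b j ab; suff e : a = b.
      by subst b; split=> //; have [rI _] := rP a; exact: rI.
    apply: fI; apply: tR => //; exists (r a i); split.
      by rewrite (proj2 (rP a)); exists i.
    by rewrite (proj2 (rP b)) ab; exists j.
  have rE k i : edge (reverse D) (r k i) (r k i.+1).
    have [_ [_ sub]] := RR (f k); apply: sub.
    by rewrite (proj2 (rP k)); exists i.
  have [|D' [H [phi [P [D'D HG sub PE]]]]] := linked_rays_quarter_grid rI rE.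
    move=> a b Z ab fZ; have [_ ba_paths] := eR (f a) (f b) (contra_not (@fI a b) ab).
    have [u [v []]] := disjoint_paths_avoid ba_paths fZ.
    rewrite (proj2 (rP a)) (proj2 (rP b)) => -[j _ <-] [i _ <-] ij.
    by exists i, j; exact: reach_reverse.
  exists (reverse D'); split; first by rewrite -(reverseK D); exact: reverse_subgraph.
  exists _, (reverse H), (fun i => reverse (column i)), phi, (reverse_paths P).
  split; first by case: HG => HG; [left|right]; exists H, column.
    exact: reverse_subdivision.
  move=> n /PE[i Pi]; exists (f i).
  rewrite reverse_subdivided Pi (proj2 (rP i)); apply: digraph_ext => [//|u v] /=.
  by split=> -[k [-> ->]]; exists k.
Qed.
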